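(* Let $\rho\in\mathbb{N}$ denote the dimension and let $d:=\rho-1$. For every $\delta\in[0,1)$ there exists a copula $A\in\mathcal{C}^\rho$ with the following properties: if $(X_1,X_2,\ldots,X_d,Y)\sim A$, then $\zeta^1(X_1,Y)=\zeta^1(X_2,Y)=\cdots=\zeta^1(X_d,Y)=0$ but $$\zeta^1((X_1,X_2,\ldots,X_d),Y)>\delta.$$
   Context: Notation: $\mathbb{I}=[0,1]$; $\lambda^k$ is $k$-dimensional Lebesgue measure, $\lambda=\lambda^1$; $\mathcal{B}(\cdot)$ denotes the Borel $\sigma$-field; $\mathcal{C}^\rho$ is the set of $\rho$-dimensional copulas, $d=\rho-1$; $A^k$ is the marginal copula of the first $k$ coordinates of $A$; $\Pi_\rho$ is the $\rho$-dimensional product copula. For a copula $C$ on $\mathbb{I}^{m}$ and $1\le k<m$, the Markov kernel $K_C:\mathbb{I}^k\times\mathcal{B}(\mathbb{I}^{m-k})\to\mathbb{I}$ with respect to the first $k$ coordinates is a (version of the) regular conditional distribution of the last $m-k$ coordinates given the first $k$. Linkage: let $(X_1,\ldots,X_d,Y)\sim A\in\mathcal{C}^\rho$ and let $\boldsymbol{R}=(R_1,\ldots,R_d)$ have i.i.d. coordinates uniform on $\mathbb{I}$, with $\boldsymbol{R}$ independent of $(X_1,\ldots,X_d,Y)$. For $2\le i\le d$ and $r\in\mathbb{I}$ set $F^{r}_{i|1\ldots i-1}(x_i|x_1,\ldots,x_{i-1})=K_{A^i}(x_1,\ldots,x_{i-1},[0,x_i))+r\,K_{A^i}(x_1,\ldots,x_{i-1},\{x_i\})$,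 where $K_{A^i}$ is the kernel with respect to the first $i-1$ coordinates, and set $F_1^{r}(x_1)=x_1$. Let $\Phi^{\boldsymbol{r}}(x_1,\ldots,x_d)=(F_1^{r_1}(x_1),F^{r_2}_{2|1}(x_2|x_1),\ldots,F^{r_d}_{d|1\ldots d-1}(x_d|x_1,\ldots,x_{d-1}))$. The linkage $L(A)$ is the distribution function of $(\Phi^{\boldsymbol{R}}(X_1,\ldots,X_d),Y)$; it is a copula whose first $d$ coordinates are jointly uniform on $\mathbb{I}^d$ (in the bivariate case $L(A)=A$). Dependence measure: for a random vector $(\boldsymbol{X},Y)$ with $\boldsymbol{X}$ of dimension $k\ge1$ and $Y$ univariate, with continuous distribution function and copula $A\in\mathcal{C}^{k+1}$, $\zeta^1(\boldsymbol{X},Y)=\zeta^1(A)=3D_1(A,\Pi_{k+1})$, where, for $A,B\in\mathcal{C}^{k+1}$, $D_1(A,B)=\int_{\mathbb{I}}\int_{\mathbb{I}^k}|K_{L(A)}(\boldsymbol{x},[0,y])-K_{L(B)}(\boldsymbol{x},[0,y])|\,d\lambda^k(\boldsymbol{x})\,d\lambda(y)$ with kernels taken with respect to the first $k$ coordinates.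
   Formalization: The dimension is restricted to ρ ≥ 3 (d ≥ 2): for ρ = 2 the claim would require ζ¹(X_1,Y) = 0 and ζ¹(X_1,Y) > δ ≥ 0 at once, and for ρ = 1 there is no X, so ζ¹ is undefined. *)

(* Defs.v *)
From HB Require Import structures.
From mathcomp Require Import all_boot all_order all_algebra.
From mathcomp Require Import all_classical all_reals all_analysis.

Set Implicit Arguments.
Unset Strict Implicit.
Unset Printing Implicit Defensive.

Import Order.TTheory GRing.Theory Num.Theory.
Import numFieldNormedType.Exports.

Local Open Scope classical_set_scope.
Local Open Scope ring_scope.

(* A point of R^n is an n.-tuple R with its product sigma-algebra. In dimension
   k.+1 the last coordinate plays the role of the response y. *)

Section coordinates.
Context {R : realType}.

Definition cube n : set (n.-tuple R) :=
  [set u | forall i, 0 <= tnth u i <= 1].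

Definition lower_orthant n (u : n.-tuple R) : set (n.-tuple R) :=
  [set z | forall i, tnth z i <= tnth u i].

(* The first i coordinates; only used for i <= n. *)
Definition first_coords i n (x : n.-tuple R) : i.-tuple R :=
  [tuple nth 0 x j | j < i].

(* lebesgue_measure, hence uniform_prob, lives on the synonym measurableTypeR R
   of R, which carries the same Borel sigma-algebra. *)
Definition cons_prod k (p : measurableTypeR R * k.-tuple R) : k.+1.-tuple R :=
  [tuple of (p.1 : R) :: p.2].

Lemma measurable_cons_prod k :
  measurable_fun [set: measurableTypeR R * k.-tuple R] (@cons_prod k).
Proof.
by apply: measurable_cons; [exact: measurable_fst | exact: measurable_snd].
Qed.

HB.instance Definition _ k :=
  isMeasurableFun.Build _ _ (measurableTypeR R * k.-tuple R)%type
    (k.+1.-tuple R) (@cons_prod k) (@measurable_cons_prod k).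

End coordinates.
Arguments cube {R} n.
Arguments first_coords {R} i {n} x.

(* The k-fold product of the uniform distribution on [0, 1], i.e. the
   restriction of k-dimensional Lebesgue measure to [0, 1]^k. *)
Fixpoint lebesgue_cube (R : realType) (k : nat) : probability (k.-tuple R) R :=
  match k with
  | 0 => @dirac _ (0.-tuple R) [tuple] R
  | k'.+1 => distribution
      (uniform_prob (@ltr01 R) \x lebesgue_cube R k')%E (@cons_prod R k')
  end.

Section copulas.
Context {R : realType}.

Definition joint_cdf d (T : measurableType d) (P : probability T R) n
    (Z : T -> n.-tuple R) (u : n.-tuple R) : R :=
  fine (P (Z @^-1` lower_orthant u)).

Definition marginal_cdf d (T : measurableType d) (P : probability T R) n
    (Z : T -> n.-tuple R) (i : 'I_n) (t : R) : R :=
  fine (P [set w | tnth (Z w) i <= t]).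

(* mu is the probability measure whose distribution function is C on the cube.
   If C is a copula, this determines mu, which then sits on the cube. *)
Definition has_cdf n (C : n.-tuple R -> R) (mu : probability (n.-tuple R) R) :=
  forall u, cube n u -> joint_cdf mu id u = C u.

(* A copula is (the restriction to the cube of) a distribution function with
   uniform univariate margins; values outside the cube are irrelevant. *)
Definition is_copula n (C : n.-tuple R -> R) :=
  exists mu : probability (n.-tuple R) R,
    (forall i t, 0 <= t <= 1 -> marginal_cdf mu id i t = t) /\ has_cdf C mu.

Definition copula_measure n (C : n.-tuple R -> R) :
  probability (n.-tuple R) R := get (@has_cdf n C).

Definition product_copula n (u : n.-tuple R) : R := \prod_(i < n) tnth u i.

(* The copula A^i of the first i coordinates: the others are set to 1. *)
Definition marginal_copula i n (A : n.-tuple R -> R) (u : i.-tuple R) : R :=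
  A [tuple nth 1 u j | j < n].

(* K is a regular conditional distribution of the last coordinate given the
   first k ones. *)
Definition is_markov_kernel k (C : k.+1.-tuple R -> R)
    (K : k.-tuple R -> set R -> \bar R) :=
  (exists K' : R.-pker (k.-tuple R) ~> R, forall x F, K x F = K' x F) /\
  (forall (E : set (k.-tuple R)) (F : set R), measurable E -> measurable F ->
    (copula_measure C [set z | E (first_coords k z) /\ F (tnth z ord_max)] =
     \int[copula_measure C]_(z in first_coords k @^-1` E)
       K (first_coords k z) F)%E).

(* A chosen version: versions agree for almost every x, and the linkage and D1
   below do not depend on the choice. *)
Definition markov_kernel k (C : k.+1.-tuple R -> R) :
    k.-tuple R -> set R -> \bar R :=
  xget (fun _ _ => 0%E) [set K | is_markov_kernel C K].

(* Coordinates are numbered from 0, so that coordinate i of Phi^r is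
   F^{r_i}(x_i | x_0, ..., x_{i-1}), given by the kernel of A^{i+1}. *)
Definition Phi k (A : k.+1.-tuple R -> R) (r x : k.-tuple R) : k.-tuple R :=
  [tuple (let K := markov_kernel (@marginal_copula i.+1 _ A) in
          let xi := tnth x i in
          if val i == 0%N then xi else
          fine (K (first_coords i x) `[0%R, xi[%classic) +
          tnth r i * fine (K (first_coords i x) [set xi])) | i < k].

(* The distribution function of (Phi^R(X), Y), on the product space where
   (X, Y) ~ A and R is uniform on the cube and independent of (X, Y). *)
Definition linkage k (A : k.+1.-tuple R -> R) : k.+1.-tuple R -> R :=
  joint_cdf (copula_measure A \x lebesgue_cube R k)%E
    (fun w => [tuple of rcons (Phi A w.2 (first_coords k w.1))
                              (tnth w.1 ord_max)]).

Definition D1 k (A B : k.+1.-tuple R -> R) : \bar R :=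
  (\int[lebesgue_measure]_(y in `[0%R, 1%R]) \int[lebesgue_cube R k]_x
    `| markov_kernel (linkage A) x `[0%R, y]%classic -
       markov_kernel (linkage B) x `[0%R, y]%classic |)%E.

Definition zeta1_copula k (A : k.+1.-tuple R -> R) : \bar R :=
  (3%:E * D1 A (@product_copula k.+1))%E.

Section random_vectors.
Context d (T : measurableType d) (P : probability T R).

Definition is_copula_of n (Z : T -> n.-tuple R) (C : n.-tuple R -> R) :=
  is_copula C /\
  forall u, joint_cdf P Z u = C [tuple marginal_cdf P Z i (tnth u i) | i < n].

(* By Sklar's theorem a copula of Z exists, and it is unique on the cube when
   the distribution function of Z is continuous. *)
Definition copula_of n (Z : T -> n.-tuple R) : n.-tuple R -> R :=
  xget (fun _ => 0) [set C | is_copula_of Z C].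

Definition random_vector k (X : 'I_k -> {RV P >-> R}) (Y : {RV P >-> R}) :
    T -> k.+1.-tuple R :=
  fun w => [tuple of rcons [tuple X i w | i < k] (Y w)].

Definition zeta1 k (X : 'I_k -> {RV P >-> R}) (Y : {RV P >-> R}) : \bar R :=
  zeta1_copula (copula_of (random_vector X Y)).

(* Z ~ A; for a copula A this forces Z to lie in the cube almost surely. *)
Definition distributed_as n (Z : T -> n.-tuple R) (A : n.-tuple R -> R) :=
  forall u, cube n u -> joint_cdf P Z u = A u.

End random_vectors.
End copulas.

(* Main.v *)
(* The copula A is the law of (U_1, ..., U_d, Y) with the U_i independent and
   uniform on [0, 1] and Y the fractional part of U_1 + ... + U_d. Since d >= 2,
   conditioning on all the U_j but one with j <> i shows that Y is uniform and
   independent of each U_i, so the copula of (U_i, Y) is the product copula and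
   zeta1 vanishes. On the other hand Y is a function of (U_1, ..., U_d), which
   is already uniform on the cube, so that L(A) = A, the conditional law of Y is
   a Dirac mass, and
     zeta1 = 3 \int_0^1 ((1 - y) y + y (1 - y)) dy = 1. *)
Require Import Defs.
From HB Require Import structures.
From mathcomp Require Import all_boot all_order all_algebra.
From mathcomp Require Import all_classical all_reals all_analysis.
From mathcomp Require Import measurable_realfun lra ring.
Import Order.TTheory GRing.Theory Num.Theory.
Import numFieldNormedType.Exports.
Local Open Scope ring_scope.

Set Implicit Arguments.
Unset Strict Implicit.
Unset Printing Implicit Defensive.

(** * Distribution functions determine measures on R^n *)

Section orthants.
Local Open Scope classical_set_scope.
Context {R : realType}.

(** The delicate point is L(A) = A. The kernels in [Phi] are chosen versions, evaluated at the sets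
    [0, x_i[ and {x_i}, which move with the conditioning point, whereas two versions of a kernel
    agree almost everywhere only for one fixed set at a time. So they are compared on [0, q] for the
    countably many rational q, and monotonicity then yields all endpoints outside a single null set.
    There the conditional distribution function of each regressor is the identity and has no atom,
    so that the randomisation by R disappears. A second obstacle is that the values of a copula
    outside the cube carry no information, while [copula_measure], [markov_kernel] and [copula_of]
    are mere choices. Every identity is therefore reduced to agreement on the cube, which determines
    a measure as soon as the margins are uniform. As the resulting zeta1 equals 1, the same copula
    serves every delta < 1. *)

Lemma ae_eq_measure d (T : measurableType d) (mu : {measure set T -> \bar R})
    (A B : set T) : measurable A -> measurable B ->
  (\forall z \ae mu, A z <-> B z) -> mu A = mu B.
Proof.
move=> mA mB AB; rewrite -[A in LHS]setIT -[B in RHS]setIT.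
rewrite -!(integral_indic mu measurableT)//.
apply: ge0_ae_eq_integral => //.
- exact/measurable_EFinP/measurable_indic.
- exact/measurable_EFinP/measurable_indic.
rewrite /ae_eq; near=> z => _; have ABz : A z <-> B z by near: z.
rewrite !indicE; congr (_%:R%:E).
congr (nat_of_bool _).
by apply/idP/idP => /set_mem/ABz/mem_set.
Unshelve. all: by end_near. Qed.

Lemma measurable_coord_le n (i : 'I_n) (t : R) :
  measurable [set z : n.-tuple R | tnth z i <= t].
Proof.
rewrite -[X in measurable X]setTI.
rewrite (_ : [set z | _] = (@tnth _ _ ^~ i) @^-1` `]-oo, t]%classic); last first.
  by apply/seteqP; split => z /=; rewrite in_itv.
exact: (@measurable_tnth _ R n i).
Qed.

Lemma lower_orthantE n (u : n.-tuple R) :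
  lower_orthant u = \bigcap_(i in [set: 'I_n]) [set z | tnth z i <= tnth u i].
Proof. by apply/seteqP; split => z /= h i => [_|]; exact: h. Qed.

Lemma measurable_lower_orthant n (u : n.-tuple R) :
  measurable (lower_orthant u).
Proof.
rewrite lower_orthantE; apply: fin_bigcap_measurable.
  exact: finite_finset.
by move=> i _; exact: measurable_coord_le.
Qed.

Lemma measurable_tupleE n :
  @measurable _ (n.-tuple R) = <<s range (@lower_orthant R n) >>.
Proof.
apply/seteqP; split; last first.
  apply: smallest_sub; first exact: sigma_algebra_measurable.
  by move=> _ [u _ <-]; exact: measurable_lower_orthant.
apply: smallest_sub; first exact: smallest_sigma_algebra.
rewrite -bigcup_seq => A [i _] [B mB <-].
have mti : measurable_fun
    [set: g_sigma_algebraType (range (@lower_orthant R n))] (@tnth n R ^~ i).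
  apply: (measurability _ (RGenOInfty.measurableE R)).
  move=> _ [_ [x ->] <-]; rewrite setTI.
  (* The corner x stays in position i while the other corners k tend to infinity: these orthants
     exhaust the half-space z_i <= x. *)
  rewrite (_ : _ @^-1` _ = ~` \bigcup_k lower_orthant
      [tuple if j == i then x else k%:R | j < n]); last first.
    apply/seteqP; split => z /=; rewrite in_itv/= andbT.
      move=> xz [k _ /(_ i)]; rewrite tnth_mktuple eqxx => /(lt_le_trans xz).
      by rewrite ltxx.
    move=> nz; rewrite ltNge; apply/negP => zx; apply: nz.
    exists (\max_(j < n) (Num.truncn `|tnth z j|).+1)%N => // j.
    rewrite tnth_mktuple; case: eqP => [->//|_].
    rewrite (le_trans (ler_norm _))// (le_trans (ltW (truncnS_gt _)))//.
    rewrite ler_nat.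
    exact: (@leq_bigmax _ (fun j => (Num.truncn `|tnth z j|).+1) j).
  apply: sigma_algebraC; apply: sigma_algebra_bigcup => k.
  by apply: sub_sigma_algebra; exists [tuple if j == i then x else k%:R | j < n].
exact: mti.
Qed.

(** The orthants form a pi-system, intersections being taken by coordinatewise minima of the
    corners, and the orthants with constant corner k exhaust the space. *)
Lemma lower_orthant_unique n (mu nu : probability (n.-tuple R) R) :
  (forall u, mu (lower_orthant u) = nu (lower_orthant u)) ->
  forall S, measurable S -> mu S = nu S.
Proof.
move=> munu; apply: (measure_unique (range (@lower_orthant R n))
    (fun k => lower_orthant [tuple k%:R | _ < n])).
- exact: measurable_tupleE.
- move=> _ _ [u _ <-] [v _ <-].
  exists [tuple Num.min (tnth u i) (tnth v i) | i < n] => //.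
  apply/seteqP; split => z /=.
    by move=> h; split=> i; have := h i; rewrite tnth_mktuple le_min => /andP[].
  by move=> [h1 h2] i; rewrite tnth_mktuple le_min h1 h2.
- by move=> k; exists [tuple k%:R | _ < n].
- apply/seteqP; split => // z _.
  exists (\max_(j < n) (Num.truncn `|tnth z j|).+1)%N => // j.
  rewrite tnth_mktuple.
  rewrite (le_trans (ler_norm _))// (le_trans (ltW (truncnS_gt _)))//.
  rewrite ler_nat.
  exact: (@leq_bigmax _ (fun j => (Num.truncn `|tnth z j|).+1) j).
- by move=> _ [u _ <-]; exact: munu.
- move=> k; apply: (@le_lt_trans _ _ 1%E); last exact: ltry.
  apply: probability_le1; exact: measurable_lower_orthant.
Qed.

Definition uniform_margins n (mu : probability (n.-tuple R) R) :=
  forall i t, 0 <= t <= 1 -> marginal_cdf mu id i t = t.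

(** Also the distribution function, on the whole line, of the uniform law on [0, 1]. *)
Definition clip01 (t : R) : R := Num.max 0 (Num.min t 1).

Definition clip n (u : n.-tuple R) : n.-tuple R :=
  [tuple clip01 (tnth u i) | i < n].

Lemma clip01_itv (t : R) : 0 <= clip01 t <= 1.
Proof. by rewrite /clip01 le_max lexx/= ge_max ler01 ge_min lexx orbT. Qed.

Lemma clip01_id (t : R) : 0 <= t <= 1 -> clip01 t = t.
Proof. by move=> /andP[t0 t1]; rewrite /clip01 min_l// max_r. Qed.

Lemma clip_cube n (u : n.-tuple R) : cube n (clip u).
Proof. by move=> i; rewrite tnth_mktuple clip01_itv. Qed.

Lemma coord_leE n (mu : probability (n.-tuple R) R) : uniform_margins mu ->
  forall i t, 0 <= t <= 1 -> mu [set z | tnth z i <= t] = t%:E.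
Proof.
move=> um i t t01; rewrite -[in RHS](um i t t01) /marginal_cdf fineK//.
by apply: fin_num_measure; exact: measurable_coord_le.
Qed.

(** The strict inequality comes from the margin at 0. It is what allows a negative corner to be
    clipped to 0: both orthants are then null. *)
Lemma uniform_margins_ae n (mu : probability (n.-tuple R) R) :
  uniform_margins mu -> \forall z \ae mu, forall i, 0 < tnth z i <= 1.
Proof.
move=> um.
suff h i : \forall z \ae mu, 0 < tnth z i <= 1.
  exact: (@filter_forall _ 'I_n (fun i z => is_true (0 < tnth z i <= 1))).
have h0 : \forall z \ae mu, 0 < tnth z i.
  exists [set z | tnth z i <= 0]; split.
  - exact: measurable_coord_le.
  - by rewrite coord_leE// lexx ler01.
  - by move=> z /= /negP; rewrite -leNgt.
have h1 : \forall z \ae mu, tnth z i <= 1.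
  exists (~` [set z | tnth z i <= 1]); split.
  - by apply: measurableC; exact: measurable_coord_le.
  - rewrite probability_setC; last exact: measurable_coord_le.
    by rewrite coord_leE ?ler01 ?lexx// subee.
  - by move=> z.
by apply: filterS2 h0 h1 => z -> ->.
Qed.

Lemma uniform_margins_orthant n (mu : probability (n.-tuple R) R) :
  uniform_margins mu ->
  forall u, mu (lower_orthant u) = mu (lower_orthant (clip u)).
Proof.
move=> um u; apply: ae_eq_measure; try exact: measurable_lower_orthant.
apply: filterS (uniform_margins_ae um) => z z01; split=> h i.
  rewrite tnth_mktuple /clip01 le_max le_min h/=.
  by have /andP[_ ->] := z01 i; rewrite orbT.
have := h i; rewrite tnth_mktuple /clip01 le_max le_min => /orP[|/andP[]//].
by have /andP[z0 _] := z01 i; rewrite leNgt z0.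
Qed.

Lemma joint_cdfE n (mu : probability (n.-tuple R) R) u :
  (joint_cdf mu id u)%:E = mu (lower_orthant u).
Proof.
by rewrite fineK// fin_num_measure//; exact: measurable_lower_orthant.
Qed.

(** A point of the cube at which the joint distribution function returns the i-th margin, provided
    that almost all the mass has coordinates at most 1. *)
Definition axis_point n (i : 'I_n) (t : R) : n.-tuple R :=
  [tuple if j == i then t else 1 | j < n].

Lemma axis_point_cube n (i : 'I_n) t : 0 <= t <= 1 -> cube n (axis_point i t).
Proof.
by move=> t01 j; rewrite tnth_mktuple; case: ifP => // _; rewrite ler01 lexx.
Qed.

Lemma orthant1_ae n (nu : probability (n.-tuple R) R) :
  nu (lower_orthant [tuple 1 | _ < n]) = 1%E ->
  \forall z \ae nu, forall j, tnth z j <= 1.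
Proof.
move=> nu1; exists (~` lower_orthant [tuple 1 | _ < n]); split.
- by apply: measurableC; exact: measurable_lower_orthant.
- rewrite probability_setC; last exact: measurable_lower_orthant.
  by rewrite nu1 subee.
- by move=> z; apply: contra_not => h j; have := h j; rewrite tnth_mktuple.
Qed.

Lemma axis_orthant n (nu : probability (n.-tuple R) R) (i : 'I_n) t :
  (\forall z \ae nu, forall j, tnth z j <= 1) ->
  nu (lower_orthant (axis_point i t)) = nu [set z | tnth z i <= t].
Proof.
move=> nu_ae; apply: ae_eq_measure.
- exact: measurable_lower_orthant.
- exact: measurable_coord_le.
apply: filterS nu_ae => z z1; split => [/(_ i)|zt j].
  by rewrite tnth_mktuple eqxx.
by rewrite tnth_mktuple; case: eqP => [->|].
Qed.

Lemma axis_uniform_margins n (nu : probability (n.-tuple R) R) :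
  nu (lower_orthant [tuple 1 | _ < n]) = 1%E ->
  (forall i t, 0 <= t <= 1 -> nu (lower_orthant (axis_point i t)) = t%:E) ->
  uniform_margins nu.
Proof.
move=> nu1 nut i t t01; apply: EFin_inj; rewrite /marginal_cdf fineK; last first.
  by apply: fin_num_measure; exact: measurable_coord_le.
by rewrite -axis_orthant ?nut//; exact: orthant1_ae.
Qed.

(** The value 1 at the corner (1, ..., 1) confines [nu] below 1 in each coordinate; its margins can
    then be read off at the axis points, which lie in the cube. *)
Lemma cube_cdf_uniform_margins n (mu nu : probability (n.-tuple R) R) :
  uniform_margins mu ->
  (forall u, cube n u -> joint_cdf nu id u = joint_cdf mu id u) ->
  uniform_margins nu.
Proof.
move=> um munu.
have munu' u : cube n u -> nu (lower_orthant u) = mu (lower_orthant u).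
  by move=> uc; rewrite -!joint_cdfE munu.
have mu_ae : \forall z \ae mu, forall j, tnth z j <= 1.
  by apply: filterS (uniform_margins_ae um) => z z01 j; case/andP: (z01 j).
apply: axis_uniform_margins => [|i t t01].
  rewrite munu'; last by move=> j; rewrite tnth_mktuple ler01 lexx.
  rewrite -(@probability_setT _ _ _ mu).
  apply: ae_eq_measure => //; first exact: measurable_lower_orthant.
  by apply: filterS mu_ae => z z1; split => // _ j; rewrite tnth_mktuple.
by rewrite munu' ?axis_orthant ?coord_leE//; exact: axis_point_cube.
Qed.

(** [nu] inherits uniform margins, so clipping reduces any orthant to one whose corner is in the
    cube. *)
Lemma cube_cdf_unique n (mu nu : probability (n.-tuple R) R) :
  uniform_margins mu ->
  (forall u, cube n u -> joint_cdf nu id u = joint_cdf mu id u) ->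
  forall S, measurable S -> nu S = mu S.
Proof.
move=> um munu; apply: lower_orthant_unique => u.
have unu := cube_cdf_uniform_margins um munu.
rewrite (uniform_margins_orthant unu) (uniform_margins_orthant um).
by rewrite -!joint_cdfE munu//; exact: clip_cube.
Qed.

(** Makes the choice hidden in [copula_measure] harmless: any explicit measure with this
    distribution function may replace it. *)
Lemma copula_measureE n (C : n.-tuple R -> R) (mu : probability (n.-tuple R) R) :
  uniform_margins mu -> has_cdf C mu ->
  forall S, measurable S -> copula_measure C S = mu S.
Proof.
move=> um Cmu; apply: cube_cdf_unique => // u uc.
by rewrite Cmu//; apply: (@getPex _ (has_cdf C)) => //; exists mu.
Qed.

Lemma eq_copula_measure n (C C' : n.-tuple R -> R) :
  (forall u, cube n u -> C u = C' u) -> copula_measure C = copula_measure C'.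
Proof.
move=> CC'; rewrite /copula_measure; congr get.
by apply/seteqP; split => mu h u uc; rewrite h// CC'.
Qed.

End orthants.

(** * Lebesgue measure on the cube *)

Section lebesgue_cube.
Local Open Scope classical_set_scope.
Context {R : realType}.
Local Notation U := (uniform_prob (@ltr01 R)).

Lemma uniform_prob01E (S : set R) : measurable S ->
  U S = lebesgue_measure (S `&` `[0, 1]).
Proof.
move=> mS; rewrite /uniform_prob integral_uniform_pdf.
rewrite (eq_integral (cst 1%E)).
  by rewrite integral_cst ?mul1e//; exact: measurableI.
move=> x /set_mem[_]; rewrite /= in_itv/= /uniform_pdf => ->.
by rewrite subr0 invr1.
Qed.

Lemma uniform_prob01_le (t : R) : U `]-oo, t] = (clip01 t)%:E.
Proof.
rewrite uniform_prob01E//.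
have -> : `]-oo, t] `&` `[0, 1] = `[0, Num.min t 1] :> set R.
  apply/seteqP; split => x /=; rewrite !in_itv/= le_min.
    by move=> [-> ->].
  by move=> /and3P[-> -> ->].
rewrite lebesgue_measure_itv/= lte_fin sube0 /clip01.
by case: ltP => h; rewrite ?(max_r (ltW h))// max_l.
Qed.

Lemma uniform_prob01_itvcc (y : R) : 0 <= y <= 1 -> U `[0, y] = y%:E.
Proof.
move=> /andP[y0 y1]; rewrite uniform_prob01E//.
rewrite (_ : _ `&` _ = `[0, y]) ?lebesgue_measure_itv/=.
  rewrite lte_fin; case: ltP => [_|y0']; first by rewrite sube0.
  by congr EFin; apply/eqP; rewrite eq_le y0 y0'.
apply/seteqP; split => t /=; rewrite !in_itv/=; first by case.
by move=> /andP[-> ty]; rewrite ty (le_trans ty).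
Qed.

Lemma tnth_first_coords i n (x : n.-tuple R) (j : 'I_i) (ij : (j < n)%N) :
  tnth (first_coords i x) j = tnth x (Ordinal ij).
Proof. by rewrite tnth_mktuple (tnth_nth 0). Qed.

Lemma tnth_first_coords_widen k (x : k.+1.-tuple R) (i : 'I_k) :
  tnth (first_coords k x) i = tnth x (widen_ord (leqnSn k) i).
Proof.
have ik : (i < k.+1)%N by rewrite ltnS ltnW.
by rewrite (tnth_first_coords x ik); congr tnth; exact: val_inj.
Qed.

Lemma measurable_first_coords i n :
  measurable_fun setT (@first_coords R i n).
Proof.
apply/measurable_fun_tnthP => j; have [ij|ij] := ltnP j n.
  rewrite (_ : _ \o _ = @tnth n R ^~ (Ordinal ij)).
    exact: measurable_tnth.
  by apply/funext => x /=; rewrite tnth_first_coords.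
rewrite (_ : _ \o _ = cst 0)//; apply/funext => x /=.
by rewrite tnth_mktuple nth_default// size_tuple.
Qed.
HB.instance Definition _ i n := isMeasurableFun.Build _ _ _ _
  (@first_coords R i n) (@measurable_first_coords i n).

Lemma measurable_tnth_comp d (T : measurableType d) k (g : T -> k.-tuple R) i :
  measurable_fun setT g -> measurable_fun setT (fun w => tnth (g w) i).
Proof.
by move=> mg; exact: (measurableT_comp (@measurable_tnth _ R k i) mg).
Qed.

Lemma measurable_first_coords_comp d (T : measurableType d) i k
    (g : T -> k.-tuple R) :
  measurable_fun setT g -> measurable_fun setT (fun w => first_coords i (g w)).
Proof.
by move=> mg; exact: (measurableT_comp (@measurable_first_coords i k) mg).
Qed.

Lemma ord_widen_or_max k (i : 'I_k.+1) :
  (exists j, i = widen_ord (leqnSn k) j) \/ i = ord_max.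
Proof.
have [ik|ik] := ltnP i k; first by left; exists (Ordinal ik); exact: val_inj.
by right; apply: val_inj; apply/eqP; rewrite eqn_leq ik -ltnS ltn_ord.
Qed.

Lemma tnth_rcons_last k (x : k.-tuple R) t :
  tnth [tuple of rcons x t] ord_max = t.
Proof. by rewrite (tnth_nth 0)/= nth_rcons size_tuple ltnn eqxx. Qed.

Lemma tnth_rcons_widen k (x : k.-tuple R) t (i : 'I_k) :
  tnth [tuple of rcons x t] (widen_ord (leqnSn k) i) = tnth x i.
Proof. by rewrite !(tnth_nth 0)/= nth_rcons size_tuple ltn_ord. Qed.

Lemma first_coords_rcons k (x : k.-tuple R) t :
  first_coords k [tuple of rcons x t] = x.
Proof.
apply: eq_from_tnth => i.
by rewrite tnth_mktuple/= nth_rcons size_tuple ltn_ord (tnth_nth 0).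
Qed.

Lemma lower_orthant_rcons k (u : k.+1.-tuple R) (x : k.-tuple R) t :
  lower_orthant u [tuple of rcons x t] <->
  lower_orthant (first_coords k u) x /\ t <= tnth u ord_max.
Proof.
split=> [h|[h1 h2] i].
  split=> [i|]; last by have := h ord_max; rewrite tnth_rcons_last.
  by rewrite tnth_first_coords_widen -(tnth_rcons_widen x t).
case: (ord_widen_or_max i) => [[j ->]|->]; last by rewrite tnth_rcons_last.
by rewrite tnth_rcons_widen -tnth_first_coords_widen.
Qed.

Lemma measurable_rcons d (T : measurableType d) k (g : T -> k.-tuple R)
    (h : T -> R) : measurable_fun setT g -> measurable_fun setT h ->
  measurable_fun setT (fun x => [tuple of rcons (g x) (h x)]).
Proof.
move=> mg mh; apply/measurable_fun_tnthP => i.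
case: (ord_widen_or_max i) => [[j ->]|->].
  rewrite (_ : _ \o _ = (fun x => tnth (g x) j)).
    exact: measurable_tnth_comp.
  by apply/funext => x /=; rewrite tnth_rcons_widen.
by rewrite (_ : _ \o _ = h)//; apply/funext => x /=; rewrite tnth_rcons_last.
Qed.

Lemma lebesgue_cube_orthant k (u : k.-tuple R) :
  lebesgue_cube R k (lower_orthant u) = (\prod_(i < k) clip01 (tnth u i))%:E.
Proof.
elim: k u => [|k IH] u.
  rewrite big_ord0 /= diracE mem_set//.
  by case.
rewrite big_ord_recl EFinM.
have -> : lebesgue_cube R k.+1 (lower_orthant u) =
  (U \x lebesgue_cube R k)%E
     (`]-oo, thead u] `*` lower_orthant [tuple of behead u]).
  rewrite /= /distribution /pushforward; congr (product_measure1 _ _ _).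
  apply/seteqP; split => -[t x] /=.
    move=> h; split.
      by rewrite in_itv/=; have := h ord0; rewrite /cons_prod/= tnth0.
    move=> i; have := h (lift ord0 i).
    by rewrite /cons_prod/= tnthS tnth_behead/= (_ : inord _ = lift ord0 i)//;
       apply: val_inj; rewrite /= inordK// ltnS.
  rewrite in_itv/= => -[t0 h] i; case: (unliftP ord0 i) => [j|] -> /=.
    rewrite /cons_prod tnthS/=; have := h j; rewrite tnth_behead.
    rewrite (_ : inord _ = lift ord0 j)//; apply: val_inj.
    by rewrite /= inordK// ltnS.
  by rewrite /cons_prod tnth0.
rewrite product_measure1E//; last exact: measurable_lower_orthant.
congr (_ * _)%E; first exact: uniform_prob01_le.
rewrite -[LHS]/(lebesgue_cube R k (lower_orthant [tuple of behead u])) IH.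
congr EFin; apply: eq_bigr => i _.
rewrite tnth_behead; congr (clip01 (tnth _ _)).
by apply: val_inj; rewrite /= inordK// ltnS.
Qed.

Lemma lebesgue_cube_margins k : uniform_margins (lebesgue_cube R k).
Proof.
apply: axis_uniform_margins => [|i t t01]; rewrite lebesgue_cube_orthant.
  by rewrite big1// => i _; rewrite tnth_mktuple clip01_id// ler01 lexx.
rewrite (bigD1 i)//= big1 ?mulr1 => [|j /negbTE ji].
  by rewrite tnth_mktuple eqxx clip01_id.
by rewrite tnth_mktuple ji clip01_id// ler01 lexx.
Qed.

Lemma lebesgue_cube_cdf k : has_cdf (@product_copula R k) (lebesgue_cube R k).
Proof.
move=> u uc; apply: EFin_inj; rewrite joint_cdfE lebesgue_cube_orthant.
by congr EFin; apply: eq_bigr => i _; rewrite clip01_id.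
Qed.

(** The tool for recognising an image measure as the uniform law on a cube. *)
Lemma lebesgue_cube_unique k (nu : probability (k.-tuple R) R) :
  (forall u, cube k u -> nu (lower_orthant u) = (product_copula u)%:E) ->
  forall S, measurable S -> nu S = lebesgue_cube R k S.
Proof.
move=> h; apply: cube_cdf_unique; first exact: lebesgue_cube_margins.
move=> u uc; apply: EFin_inj.
by rewrite joint_cdfE h// lebesgue_cube_cdf.
Qed.

Lemma product_copula_measureE k (S : set (k.-tuple R)) : measurable S ->
  copula_measure (@product_copula R k) S = lebesgue_cube R k S.
Proof.
apply: copula_measureE; first exact: lebesgue_cube_margins.
exact: lebesgue_cube_cdf.
Qed.

Lemma marginal_product_copula i k (u : i.-tuple R) : (i <= k)%N ->
  marginal_copula (@product_copula R k) u = product_copula u.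
Proof.
move=> ik; rewrite /marginal_copula /product_copula.
under eq_bigr do rewrite tnth_mktuple.
transitivity (\prod_(0 <= j < k) nth 1 u j); first by rewrite big_mkord.
rewrite (big_cat_nat (n := i))//= [X in _ * X]big_nat.
rewrite [X in _ * X]big1 ?mulr1 ?big_mkord => [|j /andP[ij _]].
  by apply: eq_bigr => j _; rewrite (tnth_nth 1).
by rewrite nth_default// size_tuple.
Qed.

(** The point at which [marginal_copula] evaluates the larger copula. *)
Definition extend1 i k (u : i.-tuple R) : k.-tuple R :=
  [tuple nth 1 u j | j < k].

Lemma extend1_cube i k (u : i.-tuple R) : cube i u -> cube k (extend1 k u).
Proof.
move=> uc j; rewrite tnth_mktuple; have [ji|ij] := ltnP j i.
  by have := uc (Ordinal ji); rewrite (tnth_nth 1).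
by rewrite nth_default ?size_tuple// ler01 lexx.
Qed.

(** Almost surely all coordinates are at most 1, so the corners set to 1 impose no constraint. *)
Lemma first_coords_orthant i k (mu : probability (k.-tuple R) R) :
  uniform_margins mu -> (i <= k)%N -> forall u : i.-tuple R,
  mu (first_coords i @^-1` lower_orthant u) = mu (lower_orthant (extend1 k u)).
Proof.
move=> um ik u; apply: ae_eq_measure.
- rewrite -[X in measurable X]setTI; apply: measurable_first_coords => //.
  exact: measurable_lower_orthant.
- exact: measurable_lower_orthant.
apply: filterS (uniform_margins_ae um) => z z1; split => h j.
  rewrite tnth_mktuple; have [ji|ij] := ltnP j i.
    have := h (Ordinal ji).
    rewrite (@tnth_first_coords _ _ z (Ordinal ji) (ltn_ord j)).
    by rewrite (tnth_nth 1 u)/= (_ : Ordinal _ = j)//; exact: val_inj.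
  by rewrite nth_default ?size_tuple//; case/andP: (z1 j).
have jk : (j < k)%N by rewrite (leq_trans _ ik).
rewrite (tnth_first_coords z jk); have := h (Ordinal jk).
by rewrite tnth_mktuple (tnth_nth 1 u).
Qed.

Lemma copula_first_coords i k (C : k.-tuple R -> R)
    (mu : probability (k.-tuple R) R) : (i <= k)%N ->
  uniform_margins mu -> has_cdf C mu ->
  (forall u, cube i u -> marginal_copula C u = product_copula u) ->
  forall E, measurable E -> mu (first_coords i @^-1` E) = lebesgue_cube R i E.
Proof.
move=> ik um Cmu CP.
apply: (@lebesgue_cube_unique i (distribution mu (@first_coords R i k))) => u uc.
transitivity (mu (first_coords i @^-1` lower_orthant u)) => //.
rewrite first_coords_orthant// -joint_cdfE Cmu.
  by rewrite -CP.
exact: extend1_cube.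
Qed.

Lemma lebesgue_cube_first_coords i k : (i <= k)%N ->
  forall E, measurable E ->
  lebesgue_cube R k (first_coords i @^-1` E) = lebesgue_cube R i E.
Proof.
move=> ik; apply: (copula_first_coords ik (@lebesgue_cube_margins k)
  (@lebesgue_cube_cdf k)) => u _.
exact: marginal_product_copula.
Qed.

Definition rcons_prod k (p : k.-tuple R * measurableTypeR R) : k.+1.-tuple R :=
  [tuple of rcons p.1 (p.2 : R)].

Lemma measurable_rcons_prod k : measurable_fun setT (@rcons_prod k).
Proof. by apply: measurable_rcons. Qed.
HB.instance Definition _ k := isMeasurableFun.Build _ _ _ _
  (@rcons_prod k) (@measurable_rcons_prod k).

Lemma first_last_setE k (E : set (k.-tuple R)) (F : set R) :
  [set z : k.+1.-tuple R | E (first_coords k z) /\ F (tnth z ord_max)] =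
  (first_coords k @^-1` E) `&` (@tnth k.+1 R ^~ ord_max @^-1` F).
Proof. by []. Qed.

Lemma measurable_first_last k (E : set (k.-tuple R)) (F : set R) :
  measurable E -> measurable F ->
  measurable [set z : k.+1.-tuple R | E (first_coords k z) /\ F (tnth z ord_max)].
Proof.
move=> mE mF; rewrite first_last_setE; apply: measurableI.
  by rewrite -[X in measurable X]setTI; exact: measurable_first_coords.
rewrite -[X in measurable X]setTI.
exact: (@measurable_tnth _ R k.+1 ord_max).
Qed.

(** [lebesgue_cube] grows by a coordinate in front, but a kernel splits off the last one. Both
    constructions have the product as distribution function, hence coincide. *)
Lemma lebesgue_cube_rcons k (E : set (k.-tuple R)) (F : set R) :
  measurable E -> measurable F ->
  lebesgue_cube R k.+1 [set z | E (first_coords k z) /\ F (tnth z ord_max)] =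
  (lebesgue_cube R k E * U F)%E.
Proof.
move=> mE mF.
have LE : forall S, measurable S ->
    (lebesgue_cube R k \x U)%E (@rcons_prod k @^-1` S) = lebesgue_cube R k.+1 S.
  apply: (@lebesgue_cube_unique k.+1
    (distribution (lebesgue_cube R k \x U)%E (@rcons_prod k))) => u uc.
  transitivity ((lebesgue_cube R k \x U)%E
      (lower_orthant (first_coords k u) `*` `]-oo, tnth u ord_max])).
    congr (product_measure1 _ _ _).
    apply/seteqP; split => -[x t] /=; rewrite in_itv/=;
      by move=> /lower_orthant_rcons.
  rewrite product_measure1E//; last exact: measurable_lower_orthant.
  rewrite [X in (X * _)%E](lebesgue_cube_orthant (first_coords k u)).
  rewrite [X in (_ * X)%E](uniform_prob01_le (tnth u ord_max)) -EFinM /product_copula.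
  rewrite big_ord_recr/= clip01_id//; congr (_ * _)%:E.
  by apply: eq_bigr => i _; rewrite tnth_first_coords_widen clip01_id.
rewrite -LE; last exact: measurable_first_last.
transitivity ((lebesgue_cube R k \x U)%E (E `*` F)).
  congr (product_measure1 _ _ _).
  apply/seteqP; split => -[x t] /=;
    by rewrite /rcons_prod/= first_coords_rcons tnth_rcons_last.
by rewrite product_measure1E.
Qed.

End lebesgue_cube.

(** * Fractional parts of sums of uniform variables *)

Section fractional_part.
Local Open Scope classical_set_scope.
Context {R : realType}.
Local Notation U := (uniform_prob (@ltr01 R)).

Definition frac_part (s : R) : R := s - (Num.floor s)%:~R.

Lemma frac_part_itv s : 0 <= frac_part s < 1.
Proof.
have /andP[h1 h2] := floor_itv s; rewrite /frac_part subr_ge0 h1/= ltrBlDl.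
by rewrite intrD1 in h2.
Qed.

Lemma frac_partE (m : int) (s : R) :
  m%:~R <= s < m%:~R + 1 -> frac_part s = s - m%:~R.
Proof. by rewrite -intrD1 /frac_part => /floor_def ->. Qed.

Lemma frac_part_addl (s t : R) :
  frac_part (frac_part s + t) = frac_part (s + t).
Proof.
have -> : s + t = frac_part s + t + (Num.floor s)%:~R by rewrite /frac_part; ring.
have /andP[h1 h2] := floor_itv (frac_part s + t); rewrite intrD1 in h2.
rewrite [RHS](@frac_partE (Num.floor (frac_part s + t) + Num.floor s)) intrD.
  by rewrite {1}/frac_part; ring.
by move: h1 h2 => ? ?; apply/andP; split; lra.
Qed.

Lemma measurable_frac_part : measurable_fun setT frac_part.
Proof.
apply: measurable_funB => //; apply: (measurability _ (RGenCInfty.measurableE R)).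
move=> _ [_ [y ->] <-]; rewrite setTI.
rewrite (_ : _ @^-1` _ = `[(Num.ceil y)%:~R, +oo[)//.
by apply/seteqP; split => s /=; rewrite !in_itv/= !andbT -floor_ge_int ceil_le_int.
Qed.

Lemma measurable_frac_part_le (c b : R) :
  measurable [set t | frac_part (c + t) <= b].
Proof.
rewrite (_ : [set _ | _] = (fun t => frac_part (c + t)) @^-1` `]-oo, b]); last first.
  by apply/seteqP; split => t /=; rewrite in_itv.
rewrite -[X in measurable X]setTI.
apply: (measurableT_comp measurable_frac_part) => //.
exact: measurable_funD.
Qed.

(** Translation modulo 1 preserves the uniform law; this is the source of every independence
    statement about Y. *)
Lemma uniform_frac_part_le (c b : R) : 0 <= b <= 1 ->
  U [set t | frac_part (c + t) <= b] = b%:E.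
Proof.
move=> /andP[b0 b1].
under eq_set do rewrite -frac_part_addl.
move: (frac_part_itv c); move: (frac_part c) => {}c /andP[c0 c1].
rewrite uniform_prob01E; last exact: measurable_frac_part_le.
(* The case b = 1 is set apart because the two intervals used below for c <= b would then share the
   endpoint 1 - c. *)
move: b1; rewrite le_eqVlt => /predU1P[->|b1].
  rewrite (_ : _ `&` _ = `[0, 1]).
    by rewrite lebesgue_measure_itv/= lte_fin ltr01 sube0.
  by apply/seteqP; split => t //= [] // *; split => //;
    have /andP[_ /ltW] := frac_part_itv (c + t).
have fl (t : R) : 0 <= t < 1 - c -> frac_part (c + t) = c + t.
  by move=> /andP[t0 t1]; rewrite (@frac_partE 0) ?subr0//; apply/andP; split; lra.
have fr (t : R) : 1 - c <= t <= 1 -> frac_part (c + t) = c + t - 1.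
  by move=> /andP[t0 t1]; rewrite (@frac_partE 1)//; apply/andP; split; lra.
(* The sum c + t wraps around at t = 1 - c. If b < c, only wrapped values are at most b, giving one
   interval; otherwise there is one interval on each side. The total length is b either way. *)
have [bc|cb] := ltP b c.
  rewrite (_ : _ `&` _ = `[1 - c, 1 - c + b]).
    rewrite lebesgue_measure_itv/= lte_fin ltrDl; case: ltP => b0'.
      by rewrite -EFinB; congr EFin; ring.
    by congr EFin; apply/eqP; rewrite eq_le b0 b0'.
  apply/seteqP; split => t /=; rewrite !in_itv/=.
    move=> [ft /andP[t0 t1]]; have [tc|ct] := ltP t (1 - c).
      by move: ft; rewrite fl ?t0//; lra.
    by move: ft; rewrite fr ?ct//; lra.
  by move=> /andP[ct tb]; rewrite fr; [split|apply/andP; split]; lra.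
rewrite (_ : _ `&` _ = `[0, b - c] `|` `[1 - c, 1]).
  rewrite measureU//=; last first.
    apply/seteqP; split => t //=; rewrite !in_itv/=.
    by move=> [/andP[t0 tb] /andP[ct t1]]; lra.
  rewrite !lebesgue_measure_itv/= !lte_fin subr_gt0 gtrBl.
  case: ltP => bc; case: ltP => c0'; rewrite -?EFinB -?EFinD; congr EFin; lra.
apply/seteqP; split => t /=; rewrite !in_itv/=.
  move=> [ft /andP[t0 t1]]; have [tc|ct] := ltP t (1 - c).
    by left; move: ft; rewrite fl ?t0//; lra.
  by right; rewrite t1.
move=> [/andP[t0 tb]|/andP[ct t1]].
  by rewrite fl; [split|]; lra.
by rewrite fr; [split|]; lra.
Qed.

Definition frac_sum k (x : k.-tuple R) : R := frac_part (\sum_(i < k) tnth x i).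

Lemma measurable_tuple_sum k :
  measurable_fun setT (fun x : k.-tuple R => \sum_(i < k) tnth x i).
Proof. by apply: measurable_sum => i; exact: measurable_tnth. Qed.

Lemma measurable_frac_sum k : measurable_fun setT (@frac_sum k).
Proof. exact: measurableT_comp measurable_frac_part (@measurable_tuple_sum k). Qed.

Lemma measurable_frac_sum_le k (c b : R) :
  measurable [set x : k.-tuple R | frac_part (c + \sum_(i < k) tnth x i) <= b].
Proof.
have m : measurable_fun setT
    (fun x : k.-tuple R => c + \sum_(i < k) tnth x i).
  by apply: measurable_funD => //; exact: measurable_tuple_sum.
rewrite -[X in measurable X]setTI.
rewrite (_ : [set _ | _] = (fun x => c + \sum_(i < k) tnth x i) @^-1`
    [set t | frac_part (0 + t) <= b]); last first.
  by apply/seteqP; split => x /=; rewrite add0r.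
exact: (m measurableT _ (measurable_frac_part_le 0 b)).
Qed.

Lemma measurable_cons_preimage k (S : set (k.+1.-tuple R)) : measurable S ->
  measurable (@cons_prod R k @^-1` S).
Proof.
by move=> mS; rewrite -[X in measurable X]setTI; exact: measurable_cons_prod.
Qed.

Lemma lebesgue_cube_cons_xsection k (S : set (k.+1.-tuple R)) : measurable S ->
  lebesgue_cube R k.+1 S =
  (\int[U]_t lebesgue_cube R k [set x | S (@cons_prod R k (t, x))])%E.
Proof.
move=> mS; apply: eq_integral => t _ /=.
rewrite (_ : xsection _ t = [set x | S (@cons_prod R k (t, x))])//.
by apply/seteqP; split => x; rewrite /xsection/= inE.
Qed.

(** Freezing all coordinates but the first takes the iterated integral in the other order; the two
    product measures agree on rectangles, hence everywhere. *)
Lemma lebesgue_cube_cons_ysection k (S : set (k.+1.-tuple R)) : measurable S ->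
  lebesgue_cube R k.+1 S =
  (\int[lebesgue_cube R k]_x U [set t | S (@cons_prod R k (t, x))])%E.
Proof.
move=> mS; transitivity ((U \x^ lebesgue_cube R k)%E (@cons_prod R k @^-1` S)).
  apply: product_measure_unique; last exact: measurable_cons_preimage.
  by move=> A B mA mB; exact: product_measure2E.
apply: eq_integral => x _ /=.
rewrite (_ : ysection _ x = [set t | S (@cons_prod R k (t, x))])//.
by apply/seteqP; split => t; rewrite /ysection/= inE.
Qed.

Lemma measurable_frac_sum_le0 k (b : R) :
  measurable [set x : k.-tuple R | frac_sum x <= b].
Proof.
have := measurable_frac_sum_le (k := k) 0 b.
by under eq_set do rewrite add0r.
Qed.

Lemma sum_cons k (t : R) (x : k.-tuple R) :
  \sum_(i < k.+1) tnth (@cons_prod R k (t, x)) i = t + \sum_(i < k) tnth x i.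
Proof. by rewrite big_ord_recl tnth0; under eq_bigr do rewrite tnthS. Qed.

Lemma tnth_cons_prod0 k (p : measurableTypeR R * k.-tuple R) :
  tnth (cons_prod p) ord0 = p.1.
Proof. exact: tnth0. Qed.

Lemma tnth_cons_prodS k (p : measurableTypeR R * k.-tuple R) i :
  tnth (cons_prod p) (lift ord0 i) = tnth p.2 i.
Proof. exact: tnthS. Qed.

(** With the other coordinates frozen, the sum is a translate of the first one. The shift c leaves
    room for a further coordinate on which to condition. *)
Lemma lebesgue_cube_frac_sum_le k (c b : R) : 0 <= b <= 1 ->
  lebesgue_cube R k.+1
    [set x | frac_part (c + \sum_(i < k.+1) tnth x i) <= b] = b%:E.
Proof.
move=> b01; rewrite lebesgue_cube_cons_ysection; last exact: measurable_frac_sum_le.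
rewrite (eq_integral (cst b%:E)) => [|x _ /=].
  rewrite integral_cst//.
  rewrite [X in (_ * X)%E](@probability_setT _ _ _ (lebesgue_cube R k)).
  by rewrite mule1.
rewrite -[RHS](uniform_frac_part_le (c + \sum_(i < k) tnth x i) b01); congr (U _).
by apply/funext => t /=; rewrite sum_cons; congr (is_true (frac_part _ <= _)); ring.
Qed.

Lemma lebesgue_cube_coord_le k (i : 'I_k) (a : R) : 0 <= a <= 1 ->
  lebesgue_cube R k [set x | tnth x i <= a] = a%:E.
Proof. by apply: coord_leE; exact: lebesgue_cube_margins. Qed.

Lemma uniform_prob01_itv (a : R) : 0 <= a <= 1 -> U [set t | t <= a] = a%:E.
Proof.
move=> a01; rewrite -[in RHS](clip01_id a01) -uniform_prob01_le.
by rewrite set_itvE.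
Qed.

(** Two coordinates are the minimum: one is constrained by a, and another must remain free to make
    the fractional part uniform. *)
Lemma coord_frac_sum_law k (i : 'I_k.+2) (a b : R) :
  0 <= a <= 1 -> 0 <= b <= 1 ->
  lebesgue_cube R k.+2 [set x | tnth x i <= a /\ frac_sum x <= b] = (a * b)%:E.
Proof.
move=> a01 b01.
have mS : measurable [set x : k.+2.-tuple R | tnth x i <= a /\ frac_sum x <= b].
  apply: measurableI; first exact: measurable_coord_le.
  exact: measurable_frac_sum_le0.
case: (unliftP ord0 i) mS => [j|] ->{i} mS.
  (* Here i is not the first coordinate, so the first one is free and all others are frozen. *)
  rewrite lebesgue_cube_cons_ysection//.
  rewrite (eq_integral (fun x => b%:E * (\1_[set x | tnth x j <= a] x)%:E)%E).
    rewrite ge0_integralZl//; last 2 first.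
    - apply/measurable_EFinP/measurable_indic; exact: measurable_coord_le.
    - by rewrite lee_fin; case/andP: b01.
    rewrite integral_indic ?setIT//; last exact: measurable_coord_le.
    by rewrite [X in (_ * X)%E](lebesgue_cube_coord_le j a01) -EFinM mulrC.
  move=> x _; rewrite indicE; have [xa|xa] := leP (tnth x j) a.
    rewrite mem_set// mule1.
    rewrite -[RHS](uniform_frac_part_le (\sum_(i < k.+1) tnth x i) b01); congr (U _).
    apply/funext => t /=; rewrite tnth_cons_prodS xa /frac_sum sum_cons addrC.
    by apply/propext; split => [[]|].
  rewrite memNset/=; last by apply/negP; rewrite -ltNge.
  rewrite mule0 -[RHS](measure0 U); congr (U _).
  by apply/seteqP; split => t //=; rewrite tnth_cons_prodS leNgt xa => -[].
(* Here i is the first coordinate: its value t becomes the shift, and the remaining k.+1 coordinates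
   are free. *)
rewrite lebesgue_cube_cons_xsection//.
rewrite (eq_integral (fun t : measurableTypeR R =>
    b%:E * (\1_[set t : R | t <= a] t)%:E)%E).
  have ma : measurable [set t : R | t <= a].
    rewrite (_ : [set t : R | t <= a] = `]-oo, a]%classic) ?set_itvE//.
    by rewrite -set_itvE; exact: measurable_itv.
  rewrite ge0_integralZl//; last 2 first.
  - exact/measurable_EFinP/measurable_indic.
  - by rewrite lee_fin; case/andP: b01.
  rewrite integral_indic ?setIT//.
  by rewrite [X in (_ * X)%E](uniform_prob01_itv a01) -EFinM mulrC.
move=> t _; rewrite indicE; have [ta|ta] := leP t a.
  rewrite mem_set// mule1 -[RHS](lebesgue_cube_frac_sum_le k t b01).
  congr (lebesgue_cube R k.+1 _); apply/funext => x /=.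
  rewrite tnth_cons_prod0 ta /frac_sum sum_cons.
  by apply/propext; split => [[]|].
rewrite memNset/=; last by apply/negP; rewrite -ltNge.
rewrite mule0 -[RHS](measure0 (lebesgue_cube R k.+1)).
congr (lebesgue_cube R k.+1 _).
by apply/seteqP; split => x //=; rewrite tnth_cons_prod0 leNgt ta => -[].
Qed.

End fractional_part.

(** * Markov kernels of copulas *)

Section kernels.
Local Open Scope classical_set_scope.
Context {R : realType}.
Local Notation U := (uniform_prob (@ltr01 R)).

Lemma eq_markov_kernel k (C C' : k.+1.-tuple R -> R) :
  (forall u, cube k.+1 u -> C u = C' u) -> markov_kernel C = markov_kernel C'.
Proof.
move=> CC'; rewrite /markov_kernel; congr (xget _ _).
by rewrite /is_markov_kernel (eq_copula_measure CC').
Qed.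

Lemma markov_kernelP k (C : k.+1.-tuple R -> R) K :
  is_markov_kernel C K -> is_markov_kernel C (markov_kernel C).
Proof.
by move=> CK; apply: (@xgetPex _ _ [set K | is_markov_kernel C K]); exists K.
Qed.

(** Covers both outcomes of the choice: a genuine kernel, or the default value 0. *)
Lemma markov_kernel_ge0_le1 k (C : k.+1.-tuple R -> R) x F : measurable F ->
  (0 <= markov_kernel C x F <= 1)%E.
Proof.
move=> mF; rewrite /markov_kernel; case: xgetP => [K _ [[K' ->] _]|_].
  by rewrite measure_ge0 -(prob_kernel (s := K') x) le_measure ?inE.
by rewrite lexx lee01.
Qed.

(* uniform_prob lives on measurableTypeR R, Markov kernels have target R. *)
Definition to_real (x : measurableTypeR R) : R := x.

Lemma measurable_to_real : measurable_fun setT to_real.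
Proof. exact: measurable_id. Qed.
HB.instance Definition _ := isMeasurableFun.Build _ _ _ _
  to_real measurable_to_real.

Lemma product_markov_kernel k :
  is_markov_kernel (@product_copula R k.+1) (fun _ => U).
Proof.
split.
  pose P : k.-tuple R -> pprobability R R :=
    cst (distribution U to_real : probability R R).
  have mP : measurable_fun setT P by exact: measurable_cst.
  by exists (kprobability mP).
move=> E F mE mF.
rewrite [LHS](product_copula_measureE (measurable_first_last mE mF)).
rewrite lebesgue_cube_rcons//.
have mE' : measurable (@first_coords R k k.+1 @^-1` E).
  by rewrite -[X in measurable X]setTI; exact: measurable_first_coords.
rewrite integral_cst// [X in (_ = _ * X)%E](product_copula_measureE mE').
by rewrite lebesgue_cube_first_coords// muleC.
Qed.

(** Uniformity of the first k coordinates moves the defining identity of a kernel to the cube, where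
    its right-hand side no longer involves K. *)
Lemma markov_kernel_integral k (C : k.+1.-tuple R -> R) K :
  is_markov_kernel C K ->
  (forall E, measurable E ->
    copula_measure C (first_coords k @^-1` E) = lebesgue_cube R k E) ->
  forall E F, measurable E -> measurable F ->
  (\int[lebesgue_cube R k]_(x in E) K x F =
   copula_measure C [set z | E (first_coords k z) /\ F (tnth z ord_max)])%E.
Proof.
move=> [[K' KK'] CK] CE E F mE mF; rewrite CK//.
have mK : measurable_fun E (fun x => K x F).
  apply: measurable_funTS.
  rewrite (_ : (fun _ => _) = (fun x => K' x F)).
    exact: measurable_kernel.
  by apply/funext => x; rewrite KK'.
have -> : (\int[copula_measure C]_(z in first_coords k @^-1` E)
    K (first_coords k z) F =
  \int[pushforward (copula_measure C) (@first_coords R k k.+1)]_(x in E) K x F)%E.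
  by rewrite ge0_integral_pushforward// => x _; rewrite KK'.
by apply: eq_measure_integral => A mA _; exact/esym/CE.
Qed.

(** Both kernels have the same integral over every E. The exceptional null set depends on F. *)
Lemma markov_kernel_unique k (C : k.+1.-tuple R -> R) K1 K2 :
  is_markov_kernel C K1 -> is_markov_kernel C K2 ->
  (forall E, measurable E ->
    copula_measure C (first_coords k @^-1` E) = lebesgue_cube R k E) ->
  forall F, measurable F -> \forall x \ae lebesgue_cube R k, K1 x F = K2 x F.
Proof.
move=> CK1 CK2 CE F mF.
have mK K : is_markov_kernel C K -> measurable_fun setT (fun x => K x F).
  move=> [[K' KK'] _]; rewrite (_ : (fun _ => _) = (fun x => K' x F)).
    exact: measurable_kernel.
  by apply/funext => x; rewrite KK'.
have : ae_eq (lebesgue_cube R k) setT (fun x => K1 x F) (fun x => K2 x F).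
  apply: integral_ae_eq => //.
  - have i1 : (lebesgue_cube R k).-integrable setT (cst 1%E).
      exact: finite_measure_integrable_cst.
    apply: le_integrable i1 => //; first exact: mK.
    move=> x _ /=; case: CK1 => [[K' ->] _].
    rewrite gee0_abs// normr1.
    by rewrite -(prob_kernel (s := K') x) le_measure ?inE.
  - exact: mK.
  - by move=> E _ mE; rewrite !(@markov_kernel_integral k C).
by apply: filterS => x; apply.
Qed.

Definition frac_graph k (x : k.-tuple R) : k.+1.-tuple R :=
  [tuple of rcons x (frac_sum x)].

Lemma measurable_frac_graph k : measurable_fun setT (@frac_graph k).
Proof. by apply: measurable_rcons => //; exact: measurable_frac_sum. Qed.
HB.instance Definition _ k := isMeasurableFun.Build _ _ _ _
  (@frac_graph k) (@measurable_frac_graph k).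

Definition frac_measure k : probability (k.+1.-tuple R) R :=
  distribution (lebesgue_cube R k) (@frac_graph k).

Definition frac_copula k : k.+1.-tuple R -> R :=
  joint_cdf (frac_measure k) id.

Lemma frac_copula_cdf k : has_cdf (@frac_copula k) (frac_measure k).
Proof. by []. Qed.

Lemma frac_measureE k (E : set (k.-tuple R)) (F : set R) :
  frac_measure k [set z | E (first_coords k z) /\ F (tnth z ord_max)] =
  lebesgue_cube R k [set x | E x /\ F (frac_sum x)].
Proof.
rewrite /frac_measure /distribution /pushforward; congr (lebesgue_cube R k _).
apply/seteqP; split => x /=;
  by rewrite /frac_graph/= first_coords_rcons tnth_rcons_last.
Qed.

Lemma lebesgue_cube_frac_sum_le0 k (b : R) : 0 <= b <= 1 ->
  lebesgue_cube R k.+1 [set x | frac_sum x <= b] = b%:E.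
Proof.
move=> b01; rewrite -(lebesgue_cube_frac_sum_le k 0 b01).
by congr (lebesgue_cube R k.+1 _); apply/funext => x; rewrite /= add0r.
Qed.

(** At least one regressor is required: an empty sum would make Y constantly 0. *)
Lemma frac_measure_margins k : uniform_margins (frac_measure k.+1).
Proof.
move=> i t t01; apply: EFin_inj; rewrite /marginal_cdf fineK; last first.
  by apply: fin_num_measure; exact: measurable_coord_le.
case: (ord_widen_or_max i) => [[j ->]|->].
  rewrite -(lebesgue_cube_coord_le j t01).
  rewrite /frac_measure /distribution /pushforward.
  congr (lebesgue_cube R k.+1 _); apply/funext => x /=.
  by rewrite /frac_graph tnth_rcons_widen.
rewrite -(lebesgue_cube_frac_sum_le0 k t01).
rewrite /frac_measure /distribution /pushforward.
congr (lebesgue_cube R k.+1 _); apply/funext => x /=.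
by rewrite /frac_graph tnth_rcons_last.
Qed.

Lemma frac_copula_measureE k S : measurable S ->
  copula_measure (@frac_copula k.+1) S = frac_measure k.+1 S.
Proof.
by apply: copula_measureE; [exact: frac_measure_margins|exact: frac_copula_cdf].
Qed.

Lemma frac_measure_first_coords k i (E : set (i.-tuple R)) : (i <= k)%N ->
  measurable E ->
  frac_measure k (first_coords i @^-1` E) = lebesgue_cube R i E.
Proof.
move=> ik mE; rewrite -(@lebesgue_cube_first_coords R i k)//.
rewrite /frac_measure /distribution /pushforward; congr (lebesgue_cube R k _).
apply/funext => x /=; congr (E _); apply: eq_from_tnth => j.
have jk : (j < k)%N by rewrite (leq_trans _ ik).
have jk1 : (j < k.+1)%N by rewrite ltnS ltnW.
rewrite (tnth_first_coords x jk) (tnth_first_coords _ jk1).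
rewrite (_ : Ordinal jk1 = widen_ord (leqnSn k) (Ordinal jk)); last exact: val_inj.
by rewrite tnth_rcons_widen.
Qed.

(** The bound on i excludes Y. The marginals entering the linkage all satisfy it, hence see
    independent regressors only. *)
Lemma marginal_frac_copula k i (u : i.-tuple R) : (i <= k.+1)%N -> cube i u ->
  marginal_copula (@frac_copula k.+1) u = product_copula u.
Proof.
move=> ik uc; apply: EFin_inj.
rewrite /marginal_copula -/(extend1 k.+2 u) joint_cdfE.
rewrite -first_coords_orthant//; [|exact: frac_measure_margins|exact: leqW].
rewrite frac_measure_first_coords//; last exact: measurable_lower_orthant.
by rewrite -joint_cdfE lebesgue_cube_cdf.
Qed.

Lemma frac_markov_kernel k :
  is_markov_kernel (@frac_copula k.+1) (fun x => \d_(frac_sum x)).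
Proof.
split; first by exists (kdirac (@measurable_frac_sum R k.+1)).
move=> E F mE mF.
rewrite [LHS](frac_copula_measureE (measurable_first_last mE mF)).
rewrite frac_measureE.
have mE' : measurable (@first_coords R k.+1 k.+2 @^-1` E).
  by rewrite -[X in measurable X]setTI; exact: measurable_first_coords.
have mF' : measurable (@frac_sum R k.+1 @^-1` F).
  by rewrite -[X in measurable X]setTI; exact: measurable_frac_sum.
have mFd D : measurable_fun D (fun x : k.+1.-tuple R => \d_(frac_sum x) F : \bar R).
  apply: measurable_funTS.
  exact: (measurable_kernel (kdirac (@measurable_frac_sum R k.+1)) _ mF).
(* The right-hand side is transported from the chosen measure to the explicit law, then to its image
   under [first_coords], and finally to the cube, where the Dirac mass becomes the indicator of the
   preimage of F. *)
transitivity (\int[frac_measure k.+1]_(z in first_coords k.+1 @^-1` E)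
   \d_(frac_sum (first_coords k.+1 z)) F)%E; last first.
  by apply: eq_measure_integral => A mA _; exact/esym/frac_copula_measureE.
transitivity (\int[pushforward (frac_measure k.+1)
    (@first_coords R k.+1 k.+2)]_(x in E) \d_(frac_sum x) F)%E; last first.
  by rewrite ge0_integral_pushforward.
transitivity (\int[lebesgue_cube R k.+1]_(x in E) \d_(frac_sum x) F)%E; last first.
  by apply: eq_measure_integral => A mA _; exact/esym/frac_measure_first_coords.
rewrite -[LHS]/(lebesgue_cube R k.+1 (E `&` (@frac_sum R k.+1 @^-1` F))).
by rewrite setIC -integral_indic.
Qed.

End kernels.

(** * The linkage of a copula with independent regressors *)

Section kernel_pullback.
Context d d' d'' (X : measurableType d) (Y : measurableType d')
  (Z : measurableType d'') (R : realType).
Variables (K : R.-pker Y ~> Z) (g : X -> Y).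

(** The composite of K and g is packaged as a kernel so that the measure of the x-section of a
    measurable set is known to be measurable in x. *)
Definition kpullback (mg : measurable_fun setT g) (x : X) :
  {measure set Z -> \bar R} := K (g x).

Hypothesis mg : measurable_fun setT g.

Let measurable_kpullback V : measurable V ->
  measurable_fun setT (kpullback mg ^~ V).
Proof.
by move=> mV; exact: (measurableT_comp (measurable_kernel K V mV) mg).
Qed.
HB.instance Definition _ := isKernel.Build _ _ _ _ _ (kpullback mg)
  measurable_kpullback.

Let kpullback_prob x : kpullback mg x setT = 1%E.
Proof. exact: prob_kernel. Qed.
HB.instance Definition _ := Kernel_isProbability.Build _ _ _ _ _
  (kpullback mg) kpullback_prob.

End kernel_pullback.

Section linkage.
Local Open Scope classical_set_scope.
Context {R : realType}.

(** In [Phi] both the conditioning point and the measured set vary with x; the set is encoded as a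
    section of one measurable set in the product. *)
Lemma measurable_kernel_section d d' (X : measurableType d)
    (Y : measurableType d') (K : R.-pker Y ~> R) (g : X -> Y)
    (A : set (X * R)) : measurable_fun setT g -> measurable A ->
  measurable_fun setT (fun x => K (g x) [set t | A (x, t)]).
Proof.
move=> mg mA.
rewrite (_ : (fun _ => _) = (fun x => kpullback K mg x (xsection A x))).
  by apply: measurable_fun_xsection_finite_kernel; rewrite inE.
apply/funext => x; rewrite /kpullback; congr (K (g x) _).
by apply/seteqP; split => t; rewrite /xsection/= inE.
Qed.

Lemma measurable_kernel_itvco d d' (X : measurableType d)
    (Y : measurableType d') (K : R.-pker Y ~> R) (g : X -> Y) (h : X -> R) :
  measurable_fun setT g -> measurable_fun setT h ->
  measurable_fun setT (fun x => K (g x) `[0, h x[).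
Proof.
move=> mg mh.
pose A := [set p : X * R | (0 <= p.2) && (p.2 < h p.1)].
have mA : measurable A.
  rewrite (_ : A =
    (fun p : X * R => (0 <= p.2) && (p.2 < h p.1)) @^-1` [set true]); last first.
    by apply/seteqP; split => p /=.
  rewrite -[X in measurable X]setTI.
  suff : measurable_fun setT (fun p : X * R => (0 <= p.2) && (p.2 < h p.1)) by exact.
  apply: measurable_and; first exact: measurable_fun_ler.
  by apply: measurable_fun_ltr => //; exact: measurableT_comp.
rewrite (_ : (fun _ => _) = (fun x => K (g x) [set t | A (x, t)])).
  exact: measurable_kernel_section.
by apply/funext => x.
Qed.

Lemma measurable_kernel_set1 d d' (X : measurableType d)
    (Y : measurableType d') (K : R.-pker Y ~> R) (g : X -> Y) (h : X -> R) :
  measurable_fun setT g -> measurable_fun setT h ->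
  measurable_fun setT (fun x => K (g x) [set h x]).
Proof.
move=> mg mh.
pose A := [set p : X * R | p.2 == h p.1].
have mA : measurable A.
  rewrite (_ : A = (fun p : X * R => p.2 == h p.1) @^-1` [set true]); last first.
    by apply/seteqP; split => p /=.
  rewrite -[X in measurable X]setTI.
  suff : measurable_fun setT (fun p : X * R => p.2 == h p.1) by exact.
  by apply: measurable_fun_eqr => //; exact: measurableT_comp.
rewrite (_ : (fun _ => _) = (fun x => K (g x) [set t | A (x, t)])).
  exact: measurable_kernel_section.
apply/funext => x; congr (K (g x) _).
by apply/seteqP; split => t; rewrite /A/= => /eqP.
Qed.

(* By monotonicity, the values at rational endpoints determine the others. *)
Lemma cdf_rat_uniform (p : {measure set R -> \bar R}) : p setT = 1%E ->
  (forall q : rat, 0 <= (ratr q : R) <= 1 -> p `[0, ratr q] = (ratr q)%:E) ->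
  forall t, 0 <= t <= 1 -> p `[0, t[ = t%:E /\ p [set t] = 0%E.
Proof.
move=> p1 pq t /andP[t0 t1].
have fp A : measurable A -> p A \is a fin_num.
  by apply: lty_fin_num_fun; rewrite p1 ltry.
have p_ge : (t%:E <= p `[0%R, t[)%E.
  rewrite -(@fineK _ (p `[0, t[))// ?fp// lee_fin leNgt; apply/negP => pt.
  have [q] := rat_in_itvoo pt; rewrite in_itv/= => /andP[pq' qt].
  have q0 : 0 <= ratr q :> R by rewrite (le_trans _ (ltW pq'))// fine_ge0.
  move: pq'; apply/negP; rewrite -leNgt -lee_fin fineK ?fp// -pq; last first.
    by rewrite q0 (le_trans (ltW qt)).
  apply: le_measure; rewrite ?inE//.
  by move=> x /=; rewrite !in_itv/= => /andP[-> /le_lt_trans ->].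
have p_le : (p `[0%R, t] <= t%:E)%E.
  rewrite -(@fineK _ (p `[0, t]))// ?fp// lee_fin leNgt; apply/negP => pt.
  have [q] := rat_in_itvoo pt; rewrite in_itv/= => /andP[tq pq'].
  (* The rational q lies below p [0, t], hence below the total mass 1, even when t = 1. *)
  have q1 : ratr q <= 1 :> R.
    rewrite (le_trans (ltW pq'))// -lee_fin fineK ?fp// -p1 le_measure ?inE//.
  move: pq'; apply/negP; rewrite -leNgt -lee_fin fineK ?fp// -pq; last first.
    by rewrite q1 (le_trans t0 (ltW tq)).
  apply: le_measure; rewrite ?inE//.
  by move=> x /=; rewrite !in_itv/= => /andP[-> /le_trans ->]//; exact: ltW.
have pD : (p `[0%R, t] = p `[0%R, t[ + p [set t])%E.
  rewrite -measureU//; last first.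
    by apply/seteqP; split => x //=; rewrite in_itv/= => -[/andP[_ xt] xE];
      rewrite xE ltxx in xt.
  congr (p _); apply/seteqP; split => x /=; rewrite !in_itv/=.
    by move=> /andP[-> ]; rewrite le_eqVlt => /predU1P[->|->]; [right|left].
  by move=> [/andP[-> /ltW ->]|->]//; rewrite t0 lexx.
(* The two bounds squeeze the atom: t + p {t} <= p [0, t] <= t. *)
have pt0 : p [set t] = 0%E.
  apply/eqP; rewrite eq_le measure_ge0 andbT.
  rewrite -(@leeD2lE _ t%:E)// adde0 (le_trans _ p_le)// pD.
  exact: leeD2r.
split=> //; apply/eqP; rewrite eq_le p_ge andbT.
by rewrite pD pt0 adde0 in p_le.
Qed.

Lemma ae_preimage d d' (T : measurableType d) (T' : measurableType d')
    (mu : {measure set T -> \bar R}) (nu : {measure set T' -> \bar R})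
    (f : T -> T') (P : T' -> Prop) : measurable_fun setT f ->
  (forall E, measurable E -> mu (f @^-1` E) = nu E) ->
  (\forall y \ae nu, P y) -> \forall x \ae mu, P (f x).
Proof.
move=> mf fE [N [mN N0 sN]]; exists (f @^-1` N); split.
- by rewrite -[X in measurable X]setTI; exact: mf.
- by rewrite fE.
- by move=> x /= nP; exact: sN.
Qed.

(** The quantifier over t is inside: one null set serves all t, so that t may later be the next
    coordinate of the same random point. *)
Lemma product_kernel_ae k : \forall x \ae lebesgue_cube R k,
  forall t, 0 <= t <= 1 ->
    markov_kernel (@product_copula R k.+1) x `[0, t[ = t%:E /\
    markov_kernel (@product_copula R k.+1) x [set t] = 0%E.
Proof.
set K := markov_kernel _.
have KP : is_markov_kernel (@product_copula R k.+1) K.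
  exact: (markov_kernelP (product_markov_kernel k)).
have Kq (q : rat) : \forall x \ae lebesgue_cube R k,
    0 <= (ratr q : R) <= 1 -> K x `[0, ratr q] = (ratr q)%:E.
  have PL E : measurable E -> copula_measure (@product_copula R k.+1)
      (first_coords k @^-1` E) = lebesgue_cube R k E.
    move=> mE; rewrite product_copula_measureE ?lebesgue_cube_first_coords//.
    by rewrite -[X in measurable X]setTI; exact: measurable_first_coords.
  have := markov_kernel_unique KP (product_markov_kernel k) PL
    (measurable_itv `[0, (ratr q : R)]%R).
  by apply: filterS => x -> q01; exact: uniform_prob01_itvcc.
(* The rationals are enumerated through [unpickle] to intersect countably many full sets; indices
   that code no rational carry a trivial statement. *)
have : \forall x \ae lebesgue_cube R k, forall n,
    if unpickle n is Some q then
      0 <= (ratr q : R) <= 1 -> K x `[0, ratr q] = (ratr q)%:E else True.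
  apply: ae_foralln => n; case: unpickle => [q|]; first exact: Kq.
  exact: aeW.
case: KP => -[K' KK'] _; apply: filterS => x hx t t01; rewrite !KK'.
apply: cdf_rat_uniform => //; first exact: prob_kernel.
move=> q q01.
by have := hx (pickle q); rewrite pickleK -KK' => ->.
Qed.

End linkage.

(** * Linkage when the regressors are independent and uniform *)

Section linkage.
Local Open Scope classical_set_scope.
Context {R : realType}.
Variables (k : nat) (C : k.+1.-tuple R -> R) (mu : probability (k.+1.-tuple R) R).
Hypothesis mu_margins : uniform_margins mu.
Hypothesis C_mu : has_cdf C mu.
Hypothesis C_product : forall i (u : i.-tuple R), (i <= k)%N -> cube i u ->
  marginal_copula C u = product_copula u.

Lemma tnth_PhiE (r x : k.-tuple R) (i : 'I_k) :
  let K := markov_kernel (@product_copula R i.+1) in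
  tnth (Phi C r x) i = if val i == 0%N then tnth x i else
    fine (K (first_coords i x) `[0, tnth x i[) +
    tnth r i * fine (K (first_coords i x) [set tnth x i]).
Proof.
rewrite tnth_mktuple /=; case: ifP => // _.
have -> // : markov_kernel (@marginal_copula R i.+1 k.+1 C) =
  markov_kernel (@product_copula R i.+1).
by apply: eq_markov_kernel => u uc; rewrite C_product.
Qed.

Lemma measurable_Phi d (T : measurableType d) (r x : T -> k.-tuple R) :
  measurable_fun setT r -> measurable_fun setT x ->
  measurable_fun setT (fun w => Phi C (r w) (x w)).
Proof.
move=> mr mx; apply/measurable_fun_tnthP => i.
rewrite (_ : _ \o _ = (fun w => tnth (Phi C (r w) (x w)) i))//.
under eq_fun do rewrite tnth_PhiE.
have mxi : measurable_fun setT (fun w => tnth (x w) i).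
  exact: measurable_tnth_comp.
have [//|i0] := eqVneq (val i) 0%N.
have mf : measurable_fun setT (fun w => first_coords i (x w)).
  exact: measurable_first_coords_comp.
have [[K' KK'] _] := markov_kernelP (@product_markov_kernel R i).
set K := markov_kernel _ in KK' *.
have mco : measurable_fun setT
    (fun w => K (first_coords i (x w)) `[0, tnth (x w) i[).
  by under eq_fun do rewrite KK'; exact: measurable_kernel_itvco.
have mset1 : measurable_fun setT
    (fun w => K (first_coords i (x w)) [set tnth (x w) i]).
  by under eq_fun do rewrite KK'; exact: measurable_kernel_set1.
have mfine : measurable_fun setT (@fine R) by exact: fine_measurable.
apply: measurable_funD; first exact: (measurableT_comp mfine mco).
apply: measurable_funM; last exact: (measurableT_comp mfine mset1).
exact: measurable_tnth_comp.
Qed.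

(** The interval term returns x_i and the atom multiplied by r_i vanishes, so the null set does not
    depend on r. *)
Lemma Phi_id_ae : \forall x \ae lebesgue_cube R k, forall r, Phi C r x = x.
Proof.
have x01 := uniform_margins_ae (@lebesgue_cube_margins R k).
have hK : \forall x \ae lebesgue_cube R k, forall (i : 'I_k) t, 0 <= t <= 1 ->
    markov_kernel (@product_copula R i.+1) (first_coords i x) `[0, t[ = t%:E /\
    markov_kernel (@product_copula R i.+1) (first_coords i x) [set t] = 0%E.
  (* There are finitely many i; for each one, the null set of the i-dimensional cube is pulled back
     along [first_coords i], which preserves the uniform law. *)
  apply: (@filter_forall _ 'I_k (fun i x => forall t, 0 <= t <= 1 -> _ /\ _)) => i.
  apply: (ae_preimage (nu := lebesgue_cube R i) (@measurable_first_coords R i k)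
    _ (@product_kernel_ae R i)) => E mE.
  by apply: lebesgue_cube_first_coords => //; exact: ltnW.
apply: filterS2 x01 hK => x x01 hK r; apply: eq_from_tnth => i.
rewrite tnth_PhiE; case: ifP => // _.
have /andP[/ltW x0 x1] := x01 i.
by have [|-> ->] := hK i (tnth x i); rewrite ?x0//= mulr0 addr0.
Qed.

Lemma copula_measure_first_coords E : measurable E ->
  copula_measure C (first_coords k @^-1` E) = lebesgue_cube R k E.
Proof.
move=> mE; rewrite -(copula_first_coords (leqnSn k) mu_margins C_mu)//.
  apply: (copula_measureE mu_margins C_mu).
  by rewrite -[X in measurable X]setTI; exact: measurable_first_coords.
by move=> u uc; rewrite C_product.
Qed.

Lemma linkage_id u : cube k.+1 u -> linkage C u = C u.
Proof.
move=> uc; rewrite -C_mu//; congr fine; rewrite /=.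
(* The randomisation lives on a second factor, so the orthant is replaced by a cylinder, to be
   compared with the linkage event almost everywhere. *)
have -> : mu (lower_orthant u) =
    (copula_measure C \x lebesgue_cube R k)%E (lower_orthant u `*` setT).
  rewrite product_measure1E//; last exact: measurable_lower_orthant.
  rewrite [X in (_ * X)%E](@probability_setT _ _ _ (lebesgue_cube R k)) mule1.
  by apply/esym/(copula_measureE mu_margins C_mu); exact: measurable_lower_orthant.
have mfst : measurable_fun setT
    (fun w : k.+1.-tuple R * k.-tuple R => first_coords k w.1).
  exact: measurable_first_coords_comp.
have mPhi : measurable_fun setT (fun w : k.+1.-tuple R * k.-tuple R =>
    Phi C w.2 (first_coords k w.1)).
  by apply: measurable_Phi => //; exact: measurable_first_coords_comp.
have mZ : measurable_fun setT (fun w : k.+1.-tuple R * k.-tuple R =>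
    [tuple of rcons (Phi C w.2 (first_coords k w.1)) (tnth w.1 ord_max)]).
  by apply: measurable_rcons => //; exact: measurable_tnth_comp.
apply: ae_eq_measure.
- rewrite -[X in measurable X]setTI.
  exact: (mZ measurableT _ (measurable_lower_orthant u)).
- by apply: measurableX => //; exact: measurable_lower_orthant.
have : \forall w \ae (copula_measure C \x lebesgue_cube R k)%E,
    forall r, Phi C r (first_coords k w.1) = first_coords k w.1.
  apply: (ae_preimage (nu := lebesgue_cube R k) mfst _ Phi_id_ae) => E mE.
  transitivity (copula_measure C (first_coords k @^-1` E)); last first.
    exact: copula_measure_first_coords.
  transitivity ((copula_measure C \x lebesgue_cube R k)%E
    ((first_coords k @^-1` E) `*` setT)).
    by congr (product_measure1 _ _ _); apply/seteqP; split => w /=; [split|case].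
  rewrite product_measure1E//.
    by rewrite [X in (_ * X)%E](@probability_setT _ _ _ (lebesgue_cube R k)) mule1.
  by rewrite -[X in measurable X]setTI; exact: measurable_first_coords.
apply: filterS => -[z r] PhiE.
have zE : [tuple of rcons (Phi C r (first_coords k z)) (tnth z ord_max)] = z.
  apply: eq_from_tnth => i; case: (ord_widen_or_max i) => [[j ->]|->].
    by rewrite tnth_rcons_widen PhiE tnth_first_coords_widen.
  by rewrite tnth_rcons_last.
split => [h|[h _]]; last by rewrite -[z in lower_orthant u z]zE in h.
by split => //; rewrite -[X in lower_orthant u X]zE.
Qed.

End linkage.

(** * An elementary integral *)

Section integral.
Local Open Scope classical_set_scope.
Context {R : realType}.

Lemma integral_parabola :
  (\int[lebesgue_measure]_(y in `[0%R, 1%R]) ((1 - y) * y + y * (1 - y))%:E =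
   (3^-1)%:E :> \bar R)%E.
Proof.
pose F (y : R) := y ^+ 2 - (2 / 3) * y ^+ 3.
have dF (y : R) : is_derive y 1 F ((1 - y) * y + y * (1 - y)).
  apply: is_derive_eq.
  have ZE (a b : R) : a *: (b : R^o) = a * b by [].
  by rewrite !ZE; field.
have cF : continuous F.
  by move=> y; apply/differentiable_continuous/derivable1_diffP; case: (dF y).
rewrite (@continuous_FTC2 _ _ F)//.
- by rewrite /F expr0n expr1n !expr0n/= !expr1n -EFinB; congr EFin; field.
- apply: continuous_subspaceT => y.
  have cB : (1 - z) @[z --> y] --> 1 - y.
    by apply: cvgB; [exact: cvg_cst|exact: cvg_id].
  by apply: cvgD; apply: cvgM => //; exact: cvg_id.
- split.
  + by move=> y _; case: (dF y).
  + by apply: cvg_at_right_filter; exact: cF.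
  + by apply: cvg_at_left_filter; exact: cF.
- by move=> y _; rewrite derive1E; case: (dF y).
Qed.
End integral.

(** * The dependence measure *)

Section zeta1.
Local Open Scope classical_set_scope.
Context {R : realType}.

(** Padding with ones keeps a point in the cube, so marginal copulas, their kernels and the copula
    measure only see the values there. *)
Lemma eq_linkage k (C C' : k.+1.-tuple R -> R) :
  (forall u, cube k.+1 u -> C u = C' u) -> linkage C = linkage C'.
Proof.
move=> CC'; have PhiE : Phi C = Phi C'.
  apply/funext => r; apply/funext => x; apply: eq_from_tnth => i.
  rewrite !tnth_mktuple; have -> // : markov_kernel (@marginal_copula R i.+1 _ C) =
    markov_kernel (@marginal_copula R i.+1 _ C').
  by apply: eq_markov_kernel => u uc; apply: CC'; exact: extend1_cube.
by rewrite /linkage PhiE (eq_copula_measure CC').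
Qed.

Lemma eq_zeta1_copula k (C C' : k.+1.-tuple R -> R) :
  (forall u, cube k.+1 u -> C u = C' u) -> zeta1_copula C = zeta1_copula C'.
Proof. by move=> CC'; rewrite /zeta1_copula /D1 (eq_linkage CC'). Qed.

(** Both kernels are the same term, whatever the linkage is; what has to be checked is finiteness,
    so that the difference cancels in the extended reals. *)
Lemma zeta1_product_copula k : zeta1_copula (@product_copula R k.+1) = 0%E.
Proof.
rewrite /zeta1_copula /D1 integral0_eq ?mule0// => y _.
rewrite integral0_eq// => x _; rewrite subee ?abse0//.
have /andP[K0 K1] := markov_kernel_ge0_le1 (linkage (@product_copula R k.+1)) x
  (measurable_itv `[0, y]%R).
by rewrite ge0_fin_numE// (le_lt_trans K1)// ltry.
Qed.

Lemma frac_copula_is_copula k : is_copula (@frac_copula R k.+1).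
Proof.
by exists (frac_measure k.+1); split; [exact: frac_measure_margins|].
Qed.

(** * From the law of a random vector to its copula *)

Section law.
Context d (T : measurableType d) (P : probability T R).
Variables (n : nat) (Z : T -> n.-tuple R) (C : n.-tuple R -> R).
Variable mu : probability (n.-tuple R) R.
Hypothesis mZ : measurable_fun setT Z.
Hypothesis mu_margins : uniform_margins mu.
Hypothesis C_mu : has_cdf C mu.
Hypothesis Z_C : distributed_as P Z C.

Lemma distributed_as_law S : measurable S -> P (Z @^-1` S) = mu S.
Proof.
pose HZ := isMeasurableFun.Build _ _ _ _ Z mZ.
pose Z' : {mfun T >-> n.-tuple R} := HB.pack Z HZ.
apply: (@cube_cdf_unique R n mu (distribution P Z')) => // u uc.
by rewrite C_mu// -Z_C.
Qed.

Lemma marginal_cdf_clip i t : marginal_cdf P Z i t = clip01 t.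
Proof.
apply: EFin_inj; rewrite -(coord_leE mu_margins i (clip01_itv t)).
rewrite /marginal_cdf fineK; last first.
  apply: fin_num_measure; rewrite -[X in measurable X]setTI.
  exact: (mZ measurableT (measurable_coord_le i t)).
rewrite -[LHS]/(P (Z @^-1` [set z | tnth z i <= t])) distributed_as_law; last first.
  exact: measurable_coord_le.
apply: ae_eq_measure; try exact: measurable_coord_le.
apply: filterS (uniform_margins_ae mu_margins) => z /(_ i) /andP[z0 z1] /=.
rewrite /clip01 le_max le_min z1 andbT.
by rewrite (_ : tnth z i <= 0 = false)//; apply/negbTE; rewrite -ltNge.
Qed.

(** [is_copula_of] quantifies over all of R^n, where the margins of Z act as [clip]; on the cube
    they act as the identity, which pins down the chosen copula there. *)
Lemma copula_of_cube u : cube n u -> copula_of P Z u = C u.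
Proof.
move=> uc; have ex : is_copula_of P Z C.
  split; first by exists mu.
  move=> v; have -> : [tuple marginal_cdf P Z i (tnth v i) | i < n] = clip v.
    by apply: eq_from_tnth => i; rewrite !tnth_mktuple marginal_cdf_clip.
  rewrite -C_mu; last exact: clip_cube.
  congr fine; rewrite distributed_as_law; last exact: measurable_lower_orthant.
  exact: uniform_margins_orthant.
have [_ /(_ u)] : is_copula_of P Z (copula_of P Z).
  by apply: (@xgetPex _ _ [set C | is_copula_of P Z C]); exists C.
have -> : [tuple marginal_cdf P Z i (tnth u i) | i < n] = u.
  apply: eq_from_tnth => i; rewrite tnth_mktuple marginal_cdf_clip.
  by rewrite clip01_id//; exact: uc.
by move=> <-; exact: Z_C.
Qed.

End law.

Lemma measurable_random_vector d (T : measurableType d) (P : probability T R) k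
    (X : 'I_k -> {RV P >-> R}) (Y : {RV P >-> R}) :
  measurable_fun setT (random_vector X Y).
Proof.
apply: measurable_rcons => //; apply/measurable_fun_tnthP => i.
rewrite (_ : _ \o _ = X i)//; apply/funext => w /=.
by rewrite tnth_mktuple.
Qed.

Lemma measurable_markov_kernel k (C : k.+1.-tuple R -> R) F : measurable F ->
  measurable_fun setT (fun x => markov_kernel C x F).
Proof.
move=> mF; rewrite /markov_kernel; case: xgetP => [K _ [[K' KK'] _]|_].
  by under eq_fun do rewrite KK'; exact: measurable_kernel.
exact: measurable_cst.
Qed.

Lemma zeta1_frac_integrand k (y : R) : 0 <= y <= 1 ->
  (\int[lebesgue_cube R k.+1]_x
    `|markov_kernel (@frac_copula R k.+1) x `[0%R, y] -
      markov_kernel (@product_copula R k.+2) x `[0%R, y]| =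
   ((1 - y) * y + y * (1 - y))%:E)%E.
Proof.
move=> y01; have /andP[y0 y1] := y01.
pose L := lebesgue_cube R k.+1.
have kerA := @frac_markov_kernel R k; have kerP := @product_markov_kernel R k.+1.
have mfirst E : measurable E -> measurable (@first_coords R k.+1 k.+2 @^-1` E).
  by move=> mE; rewrite -[X in measurable X]setTI; exact: measurable_first_coords.
have my : measurable (`[0, y]%classic : set R) by exact: measurable_itv.
have KAy : \forall x \ae L, markov_kernel (@frac_copula R k.+1) x `[0, y] =
    \d_(frac_sum x) `[0, y]%classic.
  apply: (markov_kernel_unique (markov_kernelP kerA) kerA _ my) => E mE.
  transitivity (frac_measure k.+1 (first_coords k.+1 @^-1` E)).
    by apply: frac_copula_measureE; exact: mfirst.
  exact: frac_measure_first_coords.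
have KPy : \forall x \ae L, markov_kernel (@product_copula R k.+2) x `[0, y] =
    uniform_prob (@ltr01 R) `[0, y]%classic.
  apply: (markov_kernel_unique (markov_kernelP kerP) kerP _ my) => E mE.
  transitivity (lebesgue_cube R k.+2 (first_coords k.+1 @^-1` E)).
    by apply: product_copula_measureE; exact: mfirst.
  exact: lebesgue_cube_first_coords.
pose S := [set x : k.+1.-tuple R | frac_sum x <= y].
have mS : measurable S by exact: measurable_frac_sum_le0.
have LS : L S = y%:E by exact: lebesgue_cube_frac_sum_le0.
have mI A c : measurable A -> measurable_fun setT
    (fun x : k.+1.-tuple R => c%:E * (\1_A x)%:E)%E.
  by move=> mA; apply/measurable_funeM/measurable_EFinP/measurable_indic.
(* On S the Dirac mass of [0, y] is 1 and the difference is 1 - y; off S it is 0 and the difference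
   is y in absolute value. *)
transitivity (\int[L]_x ((1 - y)%:E * (\1_S x)%:E + y%:E * (\1_(~` S) x)%:E))%E.
  apply: ge0_ae_eq_integral => //.
  - apply: measurableT_comp => //; apply: emeasurable_funB;
      exact: measurable_markov_kernel.
  - by apply: emeasurable_funD; apply: mI => //; exact: measurableC.
  - by move=> x _; rewrite adde_ge0// mule_ge0// lee_fin// subr_ge0.
  have : \forall x \ae L,
      `|markov_kernel (@frac_copula R k.+1) x `[0%R, y] -
        markov_kernel (@product_copula R k.+2) x `[0%R, y]|%E =
      ((1 - y)%:E * (\1_S x)%:E + y%:E * (\1_(~` S) x)%:E)%E.
    apply: filterS2 KAy KPy => x -> ->.
    rewrite uniform_prob01_itvcc// diracE indicC !indicE.
    have -> : (frac_sum x \in `[0, y]%classic) = (x \in S).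
      apply/idP/idP => /set_mem/= h; apply/mem_set => /=.
        by move: h; rewrite in_itv/= => /andP[].
      by rewrite in_itv/= h andbT; case/andP: (frac_part_itv (\sum_i tnth x i)).
    case: (x \in S) => /=; rewrite ?mule1 ?mule0 ?adde0 ?add0e.
      by rewrite ger0_norm// subr_ge0.
    by rewrite sub0r normrN ger0_norm.
  by apply: filterS => x xE _.
rewrite ge0_integralD//; last 4 first.
- by move=> x _; rewrite mule_ge0// lee_fin subr_ge0.
- exact: mI.
- by move=> x _; rewrite mule_ge0// lee_fin.
- by apply: mI; exact: measurableC.
rewrite !ge0_integralZl ?lee_fin ?subr_ge0//; last 2 first.
- by apply/measurable_EFinP/measurable_indic; exact: measurableC.
- exact/measurable_EFinP/measurable_indic.
rewrite !integral_indic ?setIT//; last exact: measurableC.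
have LSC : L (~` S) = (1 - y)%:E by rewrite probability_setC// LS -EFinB.
by rewrite [X in (_ * X + _)%E]LS [X in (_ + _ * X)%E]LSC -!EFinM.
Qed.

Lemma zeta1_frac_copula k : zeta1_copula (@frac_copula R k.+1) = 1%E.
Proof.
have KA : markov_kernel (linkage (@frac_copula R k.+1)) =
    markov_kernel (@frac_copula R k.+1).
  have mA i (v : i.-tuple R) : (i <= k.+1)%N -> cube i v ->
      marginal_copula (@frac_copula R k.+1) v = product_copula v.
    exact: marginal_frac_copula.
  apply: eq_markov_kernel => u uc.
  exact: (linkage_id (@frac_measure_margins R k) (@frac_copula_cdf R k.+1) mA uc).
have KP : markov_kernel (linkage (@product_copula R k.+2)) =
    markov_kernel (@product_copula R k.+2).
  have mP i (v : i.-tuple R) : (i <= k.+1)%N -> cube i v ->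
      marginal_copula (@product_copula R k.+2) v = product_copula v.
    by move=> ik _; apply: marginal_product_copula; exact: leqW.
  apply: eq_markov_kernel => u uc.
  exact: (linkage_id (@lebesgue_cube_margins R k.+2)
    (@lebesgue_cube_cdf R k.+2) mP uc).
rewrite /zeta1_copula /D1 KA KP.
rewrite (eq_integral (fun y : measurableTypeR R =>
    ((1 - y) * y + y * (1 - y))%:E)%R).
  by rewrite integral_parabola -EFinM; congr EFin; field.
move=> y /set_mem; rewrite /= in_itv/= => y01.
exact: zeta1_frac_integrand.
Qed.

End zeta1.

(** * Pairs formed by one regressor and the response *)

Section pairs.
Local Open Scope classical_set_scope.
Context {R : realType}.

(** The event on the pair constrains only coordinate i and the last one of the full vector. This is
    not an orthant in general, so the whole law of the vector is used instead of its distribution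
    function. *)
Lemma frac_pair_distributed d (T : measurableType d) (P : probability T R) k
    (X : 'I_k.+2 -> {RV P >-> R}) (Y : {RV P >-> R}) (i : 'I_k.+2) :
  distributed_as P (random_vector X Y) (@frac_copula R k.+2) ->
  distributed_as P (random_vector (fun _ : 'I_1 => X i) Y) (@product_copula R 2).
Proof.
move=> XY u uc; apply: EFin_inj.
set a := tnth u ord0; set b := tnth u ord_max.
pose E := [set x : k.+2.-tuple R | tnth x i <= a].
pose F := [set t : R | t <= b].
have mE : measurable E by exact: measurable_coord_le.
have mF : measurable F.
  by rewrite (_ : F = `]-oo, b]%classic); [exact: measurable_itv|rewrite set_itvE].
pose S := [set z : k.+3.-tuple R | E (first_coords k.+2 z) /\ F (tnth z ord_max)].
have mS : measurable S by exact: measurable_first_last.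
have -> : joint_cdf P (random_vector (fun _ : 'I_1 => X i) Y) u =
    fine (P (random_vector X Y @^-1` S)).
  congr (fine (P _)); apply/seteqP; split => w /=.
    move=> /lower_orthant_rcons[/(_ ord0)]; rewrite tnth_mktuple.
    rewrite tnth_first_coords_widen (_ : widen_ord _ _ = ord0); last exact: val_inj.
    move=> xa yb; rewrite /S/= first_coords_rcons tnth_rcons_last.
    by rewrite /E/= tnth_mktuple.
  rewrite /S/= first_coords_rcons tnth_rcons_last /E/= tnth_mktuple => -[xa yb].
  apply/lower_orthant_rcons; split => // j; rewrite tnth_mktuple.
  rewrite tnth_first_coords_widen (_ : widen_ord _ _ = ord0)//.
  by apply: val_inj; case: j => -[].
rewrite fineK; last first.
  apply: fin_num_measure; rewrite -[X in measurable X]setTI.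
  exact: (measurable_random_vector X Y measurableT mS).
rewrite (distributed_as_law (measurable_random_vector X Y)
  (@frac_measure_margins R k.+1) (@frac_copula_cdf R k.+2) XY mS).
rewrite frac_measureE coord_frac_sum_law; [|exact: uc|exact: uc].
rewrite /product_copula big_ord_recl big_ord1; congr (_ * tnth u _)%:E.
exact: val_inj.
Qed.

End pairs.

Theorem theorem5p8 (R : realType) (d : nat) (hd : (2 <= d)%N)
    (delta : R) (hdelta : 0 <= delta < 1) :
  exists A : d.+1.-tuple R -> R, is_copula A /\
    forall (disp : measure_display) (T : measurableType disp)
      (P : probability T R) (X : 'I_d -> {RV P >-> R}) (Y : {RV P >-> R}),
      distributed_as P (random_vector X Y) A ->
      (forall i : 'I_d, zeta1 (fun _ : 'I_1 => X i) Y = 0%E) /\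
      (delta%:E < zeta1 X Y)%E.
Proof.
case: d hd => [|[|k]]// _; exists (@frac_copula R k.+2).
split; first exact: frac_copula_is_copula.
move=> disp T P X Y XY; split => [i|].
  (* The chosen copula of the pair is known on the cube only, which is all that [zeta1_copula]
     depends on. *)
  rewrite -(@zeta1_product_copula R 1); apply: eq_zeta1_copula => u uc.
  apply: (copula_of_cube (measurable_random_vector (fun _ : 'I_1 => X i) Y)
    (@lebesgue_cube_margins R 2) (@lebesgue_cube_cdf R 2)) => //.
  exact: frac_pair_distributed.
rewrite (_ : zeta1 X Y = 1%E); first by rewrite lte_fin; case/andP: hdelta.
rewrite -(@zeta1_frac_copula R k.+1); apply: eq_zeta1_copula => u uc.
exact: (copula_of_cube (measurable_random_vector X Y)
  (@frac_measure_margins R k.+1) (@frac_copula_cdf R k.+2)).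
Qed.
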